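(* Let $n>p$ be positive integers with $\gcd(n,p)=t$, and let $P=(x+1)^n-\lambda x^p\in\mathbb{C}(\lambda)[x]$. Then $\mathrm{Gal}(P,\mathbb{C}(\lambda))$ has a normal subgroup isomorphic to $(S_{n/t})^t$ (the direct product of $t$ copies of the symmetric group $S_{n/t}$), and the quotient $\mathrm{Gal}(P,\mathbb{C}(\lambda))/(S_{n/t})^t$ by this subgroup is a cyclic group of order $t$.
   Context: $\lambda$ is an indeterminate, $\mathbb{C}(\lambda)$ is the field of rational functions, and $\mathrm{Gal}(P,\mathbb{C}(\lambda))$ is the Galois group of the splitting field of $P$ (as a polynomial in $x$) over $\mathbb{C}(\lambda)$. The integer $p$ is not necessarily prime. *)

(* Defs.v *)
From mathcomp Require Import all_boot all_order all_algebra all_fingroup.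
From mathcomp Require Import all_solvable all_field.
From mathcomp Require Import complex reals.
Set Implicit Arguments.
Unset Strict Implicit.
Unset Printing Implicit Defensive.
Import GRing.Theory.
Local Open Scope ring_scope.

(* [R : realType] is a copy of the real numbers, so [R[i]] is the field of
   complex numbers and [ratfun R] is the field of rational functions over it;
   ['X] is here the indeterminate of the coefficients. *)
Definition ratfun (R : realType) : fieldType := {fraction {poly R[i]}}.

Definition lambda (R : realType) : ratfun R := tofrac 'X.

(* In [lambda_poly], ['X] is the unknown x of the polynomial. *)
Definition lambda_poly (R : realType) (n p : nat) : {poly ratfun R} :=
  ('X + 1) ^+ n - lambda R *: 'X^p.

(* [P] splits into linear factors in [L] and its roots generate [L] over [F];
   [1%VS] is the copy of [F] inside [L]. *)
Definition is_splitting_field (F : fieldType) (L : splittingFieldType F)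
    (P : {poly F}) : Prop :=
  splittingFieldFor 1%VS (map_poly (in_alg L) P) {:L}%VS.

(* Main.v *)
Require Import Defs.
From mathcomp Require Import all_boot all_order all_algebra all_fingroup.
From mathcomp Require Import all_solvable all_field.
From mathcomp Require Import boolp complex reals ring mpoly.
Set Implicit Arguments.
Unset Strict Implicit.
Unset Printing Implicit Defensive.

(* With n = t m, p = t q and mu = lambda^(1/t), the trinomial is the product of the
   (x + 1)^m - z mu x^q over the t-th roots of unity z.  Let N be the stabilizer of mu.
   The argument replaces monodromy by integrality:
   - for a Galois-stable set O of roots, the product of O is a unit of the integral
     closure of C[lambda], hence constant, and comparing with the product of the
     x + 1 gives n | #|O|, so the group is transitive;
   - at lambda0 = f(p / (n - p)), f(x) = (x + 1)^n / x^p, the trinomial has a single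
     double root.  All algebraic relations between the roots persist for a suitable
     ordering of the specialized roots, which forces a transposition in the group;
   - the roots that can be swapped with a given root a form a set B contained in the
     factor of a; its product is a unit of the integral closure of C[a, 1/a], and the
     same comparison in C(a) gives m | #|B|, so B is the whole factor.
   Hence N contains all permutations preserving the t factors.  The quotient acts on
   mu by t-th roots of unity, so it is cyclic of order t. *)

Import GRing.Theory Num.Theory.
Local Open Scope ring_scope.

(** * Rational values of polynomials *)

Section RationalValues.
Variables (F L : fieldType) (ev : {rmorphism {poly F} -> L}).
Hypothesis ev_inj : injective ev.

(** When [ev] is evaluation at a transcendental a, this is membership in F(a), kept as a predicate
    so that no subfield has to be built. *)
Definition ratval (z : L) := exists A D : {poly F}, D != 0 /\ z = ev A / ev D.

Lemma ev_eq0 A : (ev A == 0) = (A == 0).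
Proof. by rewrite -(rmorph0 ev) (inj_eq ev_inj). Qed.

Lemma ratval_poly A : ratval (ev A).
Proof. by exists A, 1; rewrite oner_neq0 rmorph1 divr1. Qed.

Lemma ratvalD x y : ratval x -> ratval y -> ratval (x + y).
Proof.
move=> [A [D [D0 ->]]] [A' [D' [D'0 ->]]].
exists (A * D' + A' * D), (D * D'); rewrite mulf_neq0 //; split=> //.
by rewrite addf_div ?ev_eq0 // rmorphD !rmorphM.
Qed.

Lemma ratvalM x y : ratval x -> ratval y -> ratval (x * y).
Proof.
move=> [A [D [D0 ->]]] [A' [D' [D'0 ->]]].
by exists (A * A'), (D * D'); rewrite mulf_neq0 // mulf_div !rmorphM.
Qed.

Lemma ratvalV x : ratval x -> ratval x^-1.
Proof.
move=> [A [D [D0 ->]]]; have [->|A0] := eqVneq A 0.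
  by rewrite rmorph0 mul0r invr0 -(rmorph0 ev); apply: ratval_poly.
by exists D, A; rewrite invf_div.
Qed.

Lemma ratvalX x k : ratval x -> ratval (x ^+ k).
Proof.
move=> xR; elim: k => [|k IH]; last by rewrite exprS; apply: ratvalM.
by rewrite expr0 -(rmorph1 ev); apply: ratval_poly.
Qed.

(** The ring [{poly F}] is integrally closed: for z = A / D in lowest terms, clearing denominators
    in a monic equation of degree k gives D | A^k, so D is constant. *)
Lemma ratval_integral z : ratval z -> integralOver ev z -> exists Q, z = ev Q.
Proof.
move=> [A [D [D0 ->]]] [q q_mon].
wlog cop : A D D0 / coprimep A D.
  move=> IH; set g := gcdp A D.
  have g0 : g != 0 by rewrite gcdp_eq0 negb_and D0 orbT.
  have DE : D = D %/ g * g by rewrite divpK ?dvdp_gcdr.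
  have AE : A = A %/ g * g by rewrite divpK ?dvdp_gcdl.
  have D1 : D %/ g != 0 by apply: contraNneq D0 => D1; rewrite DE D1 mul0r.
  rewrite {1 2}AE {1 2}DE !rmorphM /= -mulf_div divff ?ev_eq0 // mulr1.
  apply: IH => //; rewrite coprimep_div_gcd // D0 orbT //.
rewrite rootE => qz.
have [k sq] : exists k, size q = k.+1.
  by exists (size q).-1; rewrite prednK // size_poly_gt0 monic_neq0.
have lq : q`_k = 1 by move/monicP: q_mon; rewrite lead_coefE sq.
have D0' : ev D != 0 by rewrite ev_eq0.
have eqz : ev (\sum_(i < k.+1) q`_i * A ^+ i * D ^+ (k - i)) = 0.
  move/eqP: qz; rewrite horner_coef size_map_inj_poly ?rmorph0 // sq => qz.
  rewrite -(mulr0 (ev D ^+ k)) -qz mulr_sumr rmorph_sum /=.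
  apply: eq_bigr => i _; rewrite coef_map_id0 ?rmorph0 // !rmorphM !rmorphXn /=.
  have -> : ev D ^+ k = ev D ^+ (k - i) * ev D ^+ i by rewrite -exprD subnK // -ltnS.
  have := expf_neq0 i D0'; rewrite expr_div_n.
  by set u := ev D ^+ i; set v := ev D ^+ (k - i); set w := ev A ^+ i => u0; field.
have := eqz; rewrite -(rmorph0 ev) => /ev_inj; rewrite big_ord_recr /=.
rewrite lq mul1r subnn mulr1 => /eqP; rewrite addr_eq0 => /eqP AkE.
have : D %| A ^+ k.
  rewrite -[A ^+ k]opprK -AkE dvdpNr; apply: (big_ind (fun B => D %| B)) => [|x y|i _].
  - exact: dvdp0.
  - exact: dvdp_add.
  - by rewrite dvdp_mull // -(subnSK (ltn_ord i)) exprS dvdp_mulr.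
move=> DA; have : D %| 1.
  by rewrite -(@Gauss_dvdpr _ 1 (A ^+ k)) ?mulr1 ?coprimep_expr // coprimep_sym.
rewrite dvdp1 => /size_poly1P [c c0 ->].
exists (c^-1 *: A); rewrite -mul_polyC rmorphM mulrC; congr (_ * _).
apply: (mulfI (x := ev c%:P)); first by rewrite ev_eq0 polyC_eq0.
by rewrite divff ?ev_eq0 ?polyC_eq0 // -rmorphM -polyCM divff // rmorph1.
Qed.

(** Both integral elements are polynomials, and their product is X^(2N); a divisor of a power of X
    is a monomial. *)
Lemma ratval_unit_monomial N e : ratval e -> e != 0 ->
    integralOver ev (ev 'X^N * e) -> integralOver ev (ev 'X^N * e^-1) ->
  exists c i, [/\ c != 0, (i <= N + N)%N & ev 'X^N * e = ev (c *: 'X^i)].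
Proof.
move=> eR e0 /ratval_integral [|Q QE]; first by apply/ratvalM/eR/ratval_poly.
move=> /ratval_integral [|Q' QE']; first by apply/ratvalM/ratvalV/eR/ratval_poly.
have QQ : Q * Q' = 'X^(N + N).
  apply: ev_inj; rewrite rmorphM -QE -QE' exprD rmorphM.
  by rewrite mulrACA divff ?mulr1.
have : Q %| ('X - 0%:P) ^+ (N + N) by rewrite subr0 -QQ dvdp_mulr.
move=> /dvdp_exp_XsubCP [i iN]; rewrite subr0 => QX.
have /eqpP [[c1 c2] /= /andP[c10 c20] cE] := QX.
exists (c1^-1 * c2), i; split=> //; first by rewrite mulf_neq0 ?invr_eq0.
by rewrite QE -scalerA -cE scalerA mulVf // scale1r.
Qed.

(** For u = A / D, compare the multiplicities of the root 0 in A^n = c X^i D^n. *)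
Lemma ratval_pow_monomial n c i u : (0 < n)%N -> ratval u -> c != 0 ->
  u ^+ n = ev (c *: 'X^i) -> (n %| i)%N.
Proof.
move=> n0 [A [D [D0 ->]]] c0; rewrite expr_div_n => /(canRL (divfK _)).
rewrite expf_neq0 ?ev_eq0 // => /(_ isT); rewrite -!rmorphXn -rmorphM => /ev_inj.
move=> AD; have A0 : A != 0.
  apply/eqP => A0; move/eqP: AD; rewrite A0 eq_sym expr0n -[_ == 0%N]negbK -lt0n n0 /=.
  by rewrite !mulf_eq0 scaler_eq0 (negPf c0) !expf_eq0 polyX_eq0 (negPf D0) !andbF.
have mupX (B : {poly F}) k : B != 0 -> mup 0 (B ^+ k) = (k * mup 0 B)%N.
  move=> B0; elim: k => [|k IH]; first by rewrite expr0 mupNroot // root1.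
  by rewrite exprS mupM ?expf_neq0 // IH mulSn.
have := congr1 (mup 0) AD; rewrite mupX //.
rewrite mupM ?expf_neq0 // ?scaler_eq0 ?negb_or ?c0 ?expf_neq0 ?polyX_eq0 //.
rewrite mupX // -mul_polyC mupMr ?rootC // -['X]subr0 mup_XsubCX eqxx => nE.
by rewrite -(dvdn_addl _ (dvdn_mulr (mup 0 D) (dvdnn n))) -nE dvdn_mulr.
Qed.

Lemma ratval_horner (q : {poly L}) x :
  (forall i, ratval q`_i) -> ratval x -> ratval q.[x].
Proof.
move=> qR xR; rewrite horner_coef.
apply: (big_ind ratval) => [|u v|i _].
- by rewrite -(rmorph0 ev); apply: ratval_poly.
- exact: ratvalD.
- by apply: ratvalM (ratvalX _ xR).
Qed.

End RationalValues.

(** * Integrality of the roots *)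

(** Since k < n, the polynomial (X + u)^n - v X^k is monic; its coefficients are integral and s is a
    root. *)
Lemma integral_trinomial (R K : comNzRingType) (f : {rmorphism R -> K})
    (s u v : K) (n k : nat) :
  integralOver f u -> integralOver f v -> (k < n)%N ->
  (s + u) ^+ n = v * s ^+ k -> integralOver f s.
Proof.
move=> ui vi kn sE.
have lin_mon : ('X + u%:P : {poly K}) \is monic.
  by rewrite -[u]opprK polyCN monicXsubC.
have pow_size : size (('X + u%:P) ^+ n : {poly K}) = n.+1.
  by rewrite -[u]opprK polyCN size_exp_XsubC.
have size_lt : (size (- (v *: 'X^k)) < size (('X + u%:P) ^+ n))%N.
  by rewrite size_polyN pow_size (leq_ltn_trans (size_scale_leq _ _)) // size_polyXn.
apply: (@integral_root_monic _ _ f s (('X + u%:P) ^+ n - v *: 'X^k)).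
- by rewrite monicE lead_coefDl // -monicE monic_exp.
- by rewrite rootE hornerD hornerN hornerZ hornerXn horner_exp !hornerE sE subrr.
apply/integral_poly => i; rewrite coefB; apply: integral_sub.
  elim: n i {sE kn size_lt pow_size} => [|n IH] i.
    by rewrite expr0 coef1; case: eqP => _; [apply: integral1 | apply: integral0].
  rewrite exprS coefM.
  apply: (big_ind (integralOver f)) => [|x y|j _]; first exact: integral0.
    exact: integral_add.
  apply: integral_mul => //; rewrite coefD coefX coefC; apply: integral_add.
    exact: integral_nat.
  by case: eqP => // _; apply: integral0.
by rewrite coefZ coefXn; apply: integral_mul => //; apply: integral_nat.
Qed.

Lemma integral_exp (R K : comNzRingType) (f : {rmorphism R -> K}) u k :
  integralOver f u -> integralOver f (u ^+ k).
Proof.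
move=> ui; elim: k => [|k IH]; first exact: integral1.
by rewrite exprS; apply: integral_mul.
Qed.

Section Evaluation.
Variables (C : numClosedFieldType) (L : fieldType) (iota : {rmorphism C -> L}).

(** Substitution of a for X, with constants embedded by [iota]; its injectivity is how transcendence
    of a over C is expressed throughout. *)
Definition ev (a : L) : {rmorphism {poly C} -> L} :=
  [the {rmorphism {poly C} -> L} of horner_eval a \o map_poly iota].

Lemma evE a A : ev a A = (map_poly iota A).[a]. Proof. by []. Qed.

Lemma evC a c : ev a c%:P = iota c.
Proof. by rewrite evE map_polyC hornerC. Qed.

Lemma evX a : ev a 'X = a.
Proof. by rewrite evE map_polyX hornerX. Qed.

Lemma evXn a k : ev a 'X^k = a ^+ k.
Proof. by rewrite rmorphXn -[X in _ = X ^+ _](evX a). Qed.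

Lemma ev_morph (g : {rmorphism L -> L}) a A :
  (forall c, g (iota c) = iota c) -> g (ev a A) = ev (g a) A.
Proof.
move=> gi; rewrite !evE -horner_map -map_poly_comp.
by congr (_.[_]); apply: eq_map_poly => c /=; rewrite gi.
Qed.

Lemma not_root_transc a (c : C) : injective (ev a) -> a != iota c.
Proof.
move=> ea; apply/eqP=> aE; have /ea /eqP : ev a 'X = ev a c%:P by rewrite evX evC.
by apply/negP; rewrite -subr_eq0 polyXsubC_eq0.
Qed.

(** As C is algebraically closed, a nonzero polynomial vanishing at a splits into linear factors, so
    a would be a constant. *)
Lemma transcP a : (forall c, a != iota c) -> injective (ev a).
Proof.
move=> aN A B /eqP; rewrite -subr_eq0 -rmorphB => /eqP AB.
apply/eqP; rewrite -subr_eq0; apply: contraTT isT => D0.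
have [rs DE] := closed_field_poly_normal (A - B).
move/eqP: AB; rewrite DE -mul_polyC rmorphM evC mulf_eq0 fmorph_eq0 lead_coef_eq0.
rewrite (negPf D0) orFb rmorph_prod prodf_seq_eq0 => /hasP[z _].
by rewrite rmorphB evX evC subr_eq0 (negPf (aN z)).
Qed.

Variables (n p : nat) (hp : (0 < p)%N) (hpn : (p < n)%N).
Variable lam : L.
Hypothesis lam_transc : injective (ev lam).

Definition isroot (a : L) := (a + 1) ^+ n = lam * a ^+ p.

Lemma n_gt0 : (0 < n)%N. Proof. exact: leq_ltn_trans hpn. Qed.

Lemma lam_neq0 : lam != 0.
Proof. by rewrite -[0](rmorph0 iota) not_root_transc. Qed.

Section Root.
Variable a : L.
Hypothesis ra : isroot a.

Lemma root_neq0 : a != 0.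
Proof.
apply/eqP => a0; move/eqP: ra; rewrite a0 add0r expr1n expr0n.
by rewrite -[p == 0%N]negbK -lt0n hp mulr0 oner_eq0.
Qed.

Lemma root1_neq0 : a + 1 != 0.
Proof.
apply/eqP => a0; move/eqP: ra; rewrite a0 expr0n -[n == 0%N]negbK -lt0n n_gt0.
by rewrite eq_sym mulf_eq0 expf_eq0 (negPf lam_neq0) (negPf root_neq0) andbF.
Qed.

Lemma lam_root : lam = (a + 1) ^+ n / a ^+ p.
Proof. by rewrite ra mulfK // expf_neq0 // root_neq0. Qed.

Lemma root_transc : injective (ev a).
Proof.
apply: transcP => c; apply/eqP => ac.
have := not_root_transc ((c + 1) ^+ n / c ^+ p) lam_transc.
by rewrite lam_root ac fmorph_div !rmorphXn rmorphD rmorph1 eqxx.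
Qed.

Lemma ratval_lam : ratval (ev a) lam.
Proof.
exists (('X + 1) ^+ n), ('X ^+ p); rewrite expf_neq0 ?polyX_eq0 //; split=> //.
by rewrite !rmorphXn rmorphD rmorph1 evX lam_root.
Qed.

Lemma integral_rootl : integralOver (ev lam) a.
Proof.
apply: (@integral_trinomial _ _ _ a 1 lam n p) => //; first exact: integral1.
by rewrite -[X in integralOver _ X]evX; apply: integral_id.
Qed.

(** Dividing the equation of a by a^n exchanges p with n - p; this gives the integrality of inverses
    of roots. *)
Lemma root_inv : (a^-1 + 1) ^+ n = lam * a^-1 ^+ (n - p).
Proof.
have a0 := root_neq0; apply: (mulIf (expf_neq0 n a0)).
have aE : a ^+ n = a ^+ p * a ^+ (n - p) by rewrite -exprD subnKC // ltnW.
rewrite -exprMn mulrDl mulVf // mul1r addrC ra aE mulrACA -exprMn.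
by rewrite mulVf // expr1n mulr1.
Qed.

Lemma integral_rootlV : integralOver (ev lam) a^-1.
Proof.
apply: (@integral_trinomial _ _ _ _ 1 lam n (n - p)%N); last exact: root_inv.
- exact: integral1.
- by rewrite -[X in integralOver _ X]evX; apply: integral_id.
by rewrite ltn_subrL hp n_gt0.
Qed.

Lemma integral_gen : integralOver (ev a) a.
Proof. by rewrite -{2}[a]evX; apply: integral_id. Qed.

(* Roots x satisfy the equation with k = p, and their inverses with k = n - p. *)
Lemma integral_root_scaled x k : (k < n)%N -> (p * k <= p * n.-1)%N ->
  (x + 1) ^+ n = lam * x ^+ k -> integralOver (ev a) (a ^+ p * x).
Proof.
move=> kn pk xE; have ai := integral_gen; have a0 := root_neq0.
(* Scaling by a^p cancels the denominator of lam = (a + 1)^n / a^p: for s = a^p x one gets (s +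
   a^p)^n = a^(p(n-1) - pk) (a + 1)^n s^k, where the exponent is nonnegative by [pk]. *)
apply: (@integral_trinomial _ _ _ _ (a ^+ p)
          (a ^+ (p * n.-1 - p * k) * (a + 1) ^+ n) n k) => //.
- exact: integral_exp.
- apply: integral_mul; apply: integral_exp => //.
  by apply: integral_add => //; apply: integral1.
rewrite -{2}[a ^+ p]mulr1 -mulrDr !exprMn xE lam_root.
rewrite -!exprM -{1}(prednK n_gt0) mulnS exprD -{1}(subnK pk) exprD.
by have := expf_neq0 p a0; set u := a ^+ p => u0; field.
Qed.

End Root.

Lemma integral_rootr a x : isroot a -> isroot x -> integralOver (ev a) (a ^+ p * x).
Proof.
move=> ra rx; apply: (@integral_root_scaled a ra x p) => //.
by rewrite leq_mul2l -ltnS prednK ?n_gt0 // hpn orbT.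
Qed.

Lemma integral_rootrV a x :
  isroot a -> isroot x -> integralOver (ev a) (a ^+ p * x^-1).
Proof.
move=> ra rx; apply: (@integral_root_scaled a ra x^-1 (n - p)) => //.
- by rewrite ltn_subrL hp n_gt0.
- by rewrite leq_mul2l -subn1 leq_sub2l // orbT.
exact: root_inv.
Qed.

Lemma unity_root_const (z : L) k : (0 < k)%N -> z ^+ k = 1 -> exists c, z = iota c.
Proof.
move=> k0 zk; have [rs XE] := closed_field_poly_normal ('X^k - 1 : {poly C}).
have : root (map_poly iota ('X^k - 1)) z.
  by rewrite rootE rmorphB rmorph1 /= map_polyXn hornerD hornerN hornerXn hornerC zk subrr.
rewrite XE (monicP (monicXnsubC 1 k0)) scale1r rmorph_prod rootE horner_prod.
rewrite prodf_seq_eq0 => /hasP[c _ /=].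
by rewrite rmorphB /= map_polyX map_polyC /= hornerXsubC subr_eq0 => /eqP; exists c.
Qed.

(** Transcendence of a turns the two equations into the polynomial identity (cX + 1)^n = c^p (X +
    1)^n; at X = -1 it gives c = 1. *)
Lemma root_ratio_const a c : isroot a -> isroot (iota c * a) -> c = 1.
Proof.
move=> ra rca; have a0 := root_neq0 ra.
have /(root_transc ra) pE : ev a ((c *: 'X + 1) ^+ n) = ev a (c ^+ p *: ('X + 1) ^+ n).
  rewrite -!mul_polyC !(rmorphM, rmorphXn, rmorphD, rmorph1) !evC evX rca ra.
  by rewrite exprMn mulrCA.
have := congr1 (horner^~ (-1)) pE.
rewrite !hornerE addNr expr0n -[n == 0%N]negbK -lt0n n_gt0 mulr0 => /eqP.
by rewrite expf_eq0 n_gt0 mulrN1 addrC subr_eq0 eq_sym => /eqP.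
Qed.

(* The product e of the xs is a unit of the integral closure of C[lam], so it is
   a constant, and the product u of the x + 1 satisfies u^n = lam^(size xs) * e^p. *)
Lemma roots_dvd_size xs : (forall x, x \in xs -> isroot x) ->
  ratval (ev lam) (\prod_(x <- xs) x) -> ratval (ev lam) (\prod_(x <- xs) (x + 1)) ->
  (n %| size xs)%N.
Proof.
move=> rxs eR uR; set e := \prod_(x <- xs) x in eR.
have e0 : e != 0.
  by rewrite prodf_seq_neq0; apply/allP=> x /rxs /root_neq0.
have uE : (\prod_(x <- xs) (x + 1)) ^+ n = lam ^+ size xs * e ^+ p.
  rewrite -!prodrXl (eq_big_seq (fun x => lam * x ^+ p)) //.
  by rewrite big_split /= big_const_seq count_predT iter_mulr_1.
(* Both e and its inverse are integral over C[lam], so N = 0 is allowed and the monomial is a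
   constant. *)
have [||c [i [c0 iN]]] := ratval_unit_monomial (N := 0) lam_transc eR e0.
- rewrite expr0 rmorph1 mul1r /e big_seq.
  apply: (big_ind (integralOver (ev lam))) => [|x y|x /rxs /integral_rootl //].
    exact: integral1.
  exact: integral_mul.
- rewrite expr0 rmorph1 mul1r /e -prodfV big_seq.
  apply: (big_ind (integralOver (ev lam))) => [|x y|x /rxs /integral_rootlV //].
    exact: integral1.
  exact: integral_mul.
move: iN; rewrite leqn0 => /eqP ->; rewrite !expr0 rmorph1 mul1r alg_polyC evC => eE.
apply: (@ratval_pow_monomial _ _ _ lam_transc n (c ^+ p) _ _ n_gt0 uR).
  exact: expf_neq0.
by rewrite uE eE -mul_polyC rmorphM evC evXn rmorphXn mulrC.
Qed.

(* Over C[a, 1/a] the product e of the xs is a unit, hence a monomial c * a^r.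
   As g fixes e and a / g a is not a constant, r = 0; now compare u^n with
   lam^(size xs), where lam = (a + 1)^n / a^p. *)
Lemma conj_roots_dvd_size (g : {rmorphism L -> L}) a xs :
  (forall c, g (iota c) = iota c) ->
  isroot a -> g a != a -> isroot (g a) -> (forall x, x \in xs -> isroot x) ->
  g (\prod_(x <- xs) x) = \prod_(x <- xs) x ->
  ratval (ev a) (\prod_(x <- xs) x) -> ratval (ev a) (\prod_(x <- xs) (x + 1)) ->
  (n %| p * size xs)%N.
Proof.
move=> gi ra gaNa rga rxs ge eR uR; set e := \prod_(x <- xs) x in ge eR.
have ea := root_transc ra; have a0 := root_neq0 ra; have ga0 := root_neq0 rga.
have e0 : e != 0.
  by rewrite prodf_seq_neq0; apply/allP=> x /rxs /root_neq0.
have uE : (\prod_(x <- xs) (x + 1)) ^+ n = lam ^+ size xs * e ^+ p.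
  rewrite -!prodrXl (eq_big_seq (fun x => lam * x ^+ p)) //.
  by rewrite big_split /= big_const_seq count_predT iter_mulr_1.
(* One factor a^p for each root makes both e and its inverse integral over C[a]. *)
set N := (p * size xs)%N.
have int_prod (f : L -> L) : (forall x, x \in xs -> integralOver (ev a) (a ^+ p * f x)) ->
    integralOver (ev a) (ev a 'X^N * \prod_(x <- xs) f x).
  move=> fi; have -> : ev a 'X^N * \prod_(x <- xs) f x = \prod_(x <- xs) (a ^+ p * f x).
    by rewrite big_split /= big_const_seq count_predT iter_mulr_1 -exprM -evXn.
  rewrite big_seq; apply: (big_ind (integralOver (ev a))) => //; first exact: integral1.
  exact: integral_mul.
have [||c [i [c0 _]]] := ratval_unit_monomial (N := N) ea eR e0.
- by apply: int_prod => x /rxs; apply: integral_rootr.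
- by rewrite /e -prodfV; apply: int_prod => x /rxs; apply: integral_rootrV.
rewrite -mul_polyC rmorphM evC !evXn => eE.
have gE : g a ^+ N * e = iota c * g a ^+ i.
  by have := congr1 g eE; rewrite !rmorphM !rmorphXn ge gi.
have c0' : iota c != 0 by rewrite fmorph_eq0.
(* Compare a^N e = c a^i with its image under g, which leaves e and c unchanged. *)
have eq_Ni : (g a / a) ^+ N = (g a / a) ^+ i.
  rewrite !expr_div_n; apply/eqP; rewrite eqr_div ?expf_neq0 //; apply/eqP.
  by apply: (mulIf e0); rewrite mulrAC gE -[RHS]mulrA eE; ring.
(* Otherwise g a / a is a root of unity, hence a constant, hence 1 by [root_ratio_const], although g
   moves a. *)
have iN : i = N.
  apply: contra_neq_eq gaNa => iN.
  have [k k0 kE] : exists2 k, (0 < k)%N & (g a / a) ^+ k = 1.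
    have z0 : g a / a != 0 by rewrite mulf_neq0 ?invr_eq0.
    have [iltN|Nlti|/esym/eqP] := ltngtP i N; last by rewrite eq_sym (negPf iN).
      exists (N - i)%N; first by rewrite subn_gt0.
      by rewrite expfB // eq_Ni divff ?expf_neq0.
    exists (i - N)%N; first by rewrite subn_gt0.
    by rewrite expfB // eq_Ni divff ?expf_neq0.
  have [d dE] := unity_root_const k0 kE.
  have gaE : g a = iota d * a by rewrite -dE divfK.
  have d1 : d = 1 by apply: root_ratio_const ra _; rewrite -gaE.
  by rewrite gaE d1 rmorph1 mul1r.
have {}eE : e = iota c.
  by apply: (mulfI (expf_neq0 N a0)); rewrite eE iN mulrC.
(* Because lam = (a + 1)^n / a^p and e = c, the n-th power of w is the monomial c^(-p) a^N. *)
set w := (a + 1) ^+ size xs / \prod_(x <- xs) (x + 1).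
have u0 : \prod_(x <- xs) (x + 1) != 0.
  by rewrite prodf_seq_neq0; apply/allP=> x /rxs /root1_neq0.
apply: (@ratval_pow_monomial _ _ _ ea n (c^-1 ^+ p) _ w n_gt0).
- apply: ratvalM => //; last exact: ratvalV.
  have -> : (a + 1) ^+ size xs = ev a (('X + 1) ^+ size xs).
    by rewrite rmorphXn rmorphD rmorph1 evX.
  exact: ratval_poly.
- by rewrite expf_neq0 // invr_eq0.
rewrite /w expr_div_n uE eE (lam_root ra) -mul_polyC rmorphM evC evXn.
rewrite expr_div_n -!exprM [(size xs * n)%N]mulnC rmorphXn fmorphV /N exprVn.
rewrite !invfM invrK mulrA mulrA divff ?mul1r 1?mulrC //.
by rewrite expf_neq0 // root1_neq0.
Qed.

End Evaluation.

(** * Specialization of algebraic relations *)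

Lemma poly_nonroot (R : numDomainType) (p : {poly R}) : p != 0 -> exists c, ~~ root p c.
Proof.
move=> p0; pose rs := [seq (i%:R : R) | i <- iota 0 (size p)].
have rs_uniq : uniq rs.
  by rewrite map_inj_uniq ?iota_uniq // => i j /eqP; rewrite eqr_nat => /eqP.
have [all_root|] := boolP (all (root p) rs).
  by have := max_poly_roots p0 all_root rs_uniq; rewrite size_map size_iota ltnn.
by case/allPn => c _ cp; exists c.
Qed.

Lemma common_nonroot (R : numDomainType) (I : finType) (q : I -> {poly R}) :
  (forall i, q i != 0) -> exists c, forall i, (q i).[c] != 0.
Proof.
move=> q0; have : \prod_i q i != 0 by apply/prodf_neq0 => i _.
case/poly_nonroot => c; rewrite rootE horner_prod => /prodf_neq0 qc.
by exists c => i; apply: qc.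
Qed.

Section Mmap.
Variables (n : nat) (R S T : comNzRingType).

Lemma rmorph_mmap (g : {rmorphism S -> T}) (f : R -> S) h (q : {mpoly R[n]}) :
  g (mmap f h q) = mmap (g \o f) (g \o h) q.
Proof.
rewrite /mmap rmorph_sum; apply: eq_bigr => m _; rewrite rmorphM rmorph_prod.
by congr (_ * _); apply: eq_bigr => i _; rewrite rmorphXn.
Qed.

Lemma eq_mmap (f f' : R -> S) h h' (q : {mpoly R[n]}) :
  f =1 f' -> h =1 h' -> mmap f h q = mmap f' h' q.
Proof.
move=> ff hh; rewrite /mmap; apply: eq_bigr => m _; rewrite ff; congr (_ * _).
by apply: eq_bigr => i _; rewrite hh.
Qed.

Lemma mmapXU (f : {rmorphism R -> S}) h i : mmap f h ('X_i : {mpoly R[n]}) = h i.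
Proof. by rewrite mmapX mmap1U. Qed.

Lemma mmap_mesym (f : {rmorphism R -> S}) h k :
  mmap f h (mesym n R k) = (mesym n S k).@[h].
Proof.
rewrite /mesym !rmorph_sum; apply: eq_bigr => A _; rewrite !rmorph_prod.
by apply: eq_bigr => i _ /=; rewrite mmapXU mevalXU.
Qed.

End Mmap.

Lemma mmap_horner n (R S : comNzRingType) (f : {rmorphism R -> S}) h i (Q : {poly R}) :
  mmap f h (map_poly (@mpolyC n R) Q).['X_i] = (map_poly f Q).[h i].
Proof.
rewrite -horner_map -map_poly_comp /= mmapXU; congr (_.[_]).
by apply: eq_map_poly => c /=; rewrite mmapC.
Qed.

Lemma meval_msym n (R : comNzRingType) (s : 'S_n) (q : {mpoly R[n]}) h :
  (msym s q).@[h] = q.@[fun i => h (s i)].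
Proof.
by rewrite /msym /meval rmorph_mmap; apply: eq_mmap => i /=; rewrite ?mmapC ?mmapXU.
Qed.

Section Specialization.
Variables (C : numClosedFieldType) (L : fieldType) (iota : {rmorphism C -> L}).
Variables (lam : L) (lam0 : C) (n : nat).
Hypothesis lam_transc : injective (ev iota lam).
Variables (PP : {poly {poly C}}) (r : 'I_n -> L) (rho : 'I_n -> C).
Hypothesis PPr : map_poly (ev iota lam) PP = \prod_i ('X - (r i)%:P).
Hypothesis PPrho : map_poly (horner_eval lam0) PP = \prod_i ('X - (rho i)%:P).

Lemma mesym_roots (F : fieldType) (x : 'I_n -> F) (k : 'I_n.+1) :
  (mesym n F k).@[x] = (-1) ^+ k * (\prod_i ('X - (x i)%:P))`_(n - k).
Proof.
have -> : \prod_i ('X - (x i)%:P) = \prod_(c <- [tuple x i | i < n]) ('X - c%:P).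
  by rewrite big_tuple; apply: eq_bigr => i _; rewrite tnth_mktuple.
rewrite mroots_coeff mulrA -expr2 sqrr_sign mul1r.
by apply: meval_eq => i; rewrite tnth_mktuple.
Qed.

(** By the fundamental theorem q is a polynomial in the elementary symmetric functions, whose values
    are up to sign the coefficients of [PP]. Substituting these coefficients gives Q, and the two
    values of q come from sending its variable to lam and to lam0. *)
Lemma sym_eval (q : {mpoly C[n]}) : q \is symmetric ->
  exists Q, mmap iota r q = ev iota lam Q /\ q.@[rho] = Q.[lam0].
Proof.
move=> /sym_fundamental [w [<- _]].
(* By Vieta, [E i] stands for the elementary symmetric function of degree i + 1, the index starting
   at 0. *)
pose E (i : 'I_n) : {poly C} := (-1) ^+ i.+1 * PP`_(n - i.+1).
exists (mmap polyC E w); split.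
  rewrite !rmorph_mmap; apply: eq_mmap => [c|i] /=.
    by rewrite mmapC; apply/esym/evC.
  rewrite tnth_mktuple mmap_mesym (mesym_roots _ (lift ord0 i)) /= -PPr coef_map.
  by rewrite -[RHS]/(ev iota lam (E i)) rmorphM rmorphXn rmorphN1.
rewrite -[RHS]/(horner_eval lam0 _) /meval !rmorph_mmap.
apply: eq_mmap => [c|i] /=; first by rewrite mmapC /horner_eval hornerC.
rewrite tnth_mktuple mmap_mesym (mesym_roots _ (lift ord0 i)) /= -PPrho coef_map.
by rewrite -[RHS]/(horner_eval lam0 (E i)) rmorphM rmorphXn rmorphN1.
Qed.

(* If every ordering of the rho's violated a relation F_s between the r's, a
   generic combination G of the F_s would be violated by all orderings, and the
   symmetrization of G would be a relation over C[lam] violated at lam0. *)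
Lemma specialization : exists s : 'S_n, forall q : {mpoly C[n]},
  mmap iota r q = 0 -> q.@[fun i => rho (s i)] = 0.
Proof.
apply: contrapT => /forallNP nsp.
have /fin_all_exists [F FP] : forall s : 'S_n, exists q : {mpoly C[n]},
    mmap iota r q = 0 /\ q.@[fun i => rho (s i)] != 0.
  move=> s; have /existsNP[q /not_implyP[q0 /eqP qs]] := nsp s.
  by exists q.
(* The value at the ordering s of the combination of the F_s' with coefficients t^(rank of s'), as a
   polynomial in t. Its coefficient at the rank of s is nonzero. *)
pose pol (s : 'S_n) : {poly C} :=
  \sum_(s' : 'S_n) (F s').@[fun i => rho (s i)] *: 'X^(enum_rank s').
have pol0 s : pol s != 0.
  apply/eqP => /(congr1 (coefp (enum_rank s))) /eqP.
  rewrite /coefp coef0 coef_sum (bigD1 s) //= coefZ coefXn eqxx mulr1 big1 ?addr0.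
    by rewrite (negPf (FP s).2).
  move=> s' ss'; rewrite coefZ coefXn (inj_eq val_inj) (inj_eq enum_rank_inj).
  by rewrite eq_sym (negPf ss') mulr0.
have [t tP] := common_nonroot pol0.
pose G : {mpoly C[n]} := \sum_(s : 'S_n) t ^+ enum_rank s *: F s.
have Gr : mmap iota r G = 0.
  by rewrite rmorph_sum big1 // => s _; rewrite /= mmapZ (FP s).1 mulr0.
have Grho (s : 'S_n) : G.@[fun i => rho (s i)] != 0.
  suff -> : G.@[fun i => rho (s i)] = (pol s).[t] by apply: tP.
  rewrite rmorph_sum horner_sum; apply: eq_bigr => s' _.
  by rewrite /= mevalZ hornerZ hornerXn mulrC.
pose S := \prod_(s : 'S_n) msym s G.
have Ssym : S \is symmetric.
  apply/issymP => s; rewrite /S rmorph_prod /=.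
  rewrite [RHS](reindex_inj (mulIg s)) /=; apply: eq_bigr => s' _.
  by rewrite msymMm.
have [Q [Qr Qrho]] := sym_eval Ssym.
have : ev iota lam Q = 0.
  by rewrite -Qr /S rmorph_prod (bigD1 1%g) //= msym1m Gr mul0r.
rewrite -(rmorph0 (ev iota lam)) => /lam_transc Q0.
move/eqP: Qrho; rewrite Q0 horner0 /S rmorph_prod => /prodf_eq0[s _].
by rewrite /= meval_msym (negPf (Grho s)).
Qed.

End Specialization.

(** * Trinomials *)

(** The ring is arbitrary because the same shape occurs over C(lambda), over L, over C[lambda], at a
    specialized value in C, and for the t factors of the polynomial. *)
Definition trinomial (R : nzRingType) (n p : nat) (c : R) : {poly R} :=
  ('X + 1) ^+ n - c *: 'X^p.

Lemma map_trinomial (R S : nzRingType) (f : {rmorphism R -> S}) n p c :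
  map_poly f (trinomial n p c) = trinomial n p (f c).
Proof.
by rewrite rmorphB rmorphXn rmorphD rmorph1 /= map_polyX linearZ /= map_polyXn.
Qed.


Section Trinomial.
Variables (F : fieldType) (n p : nat) (hp : (0 < p)%N) (hpn : (p < n)%N).
Variable c : F.
Local Notation P := (trinomial n p c).

Lemma size_trinomial : size P = n.+1.
Proof.
have size_pow : size (('X + 1) ^+ n : {poly F}) = n.+1.
  by rewrite -[1]opprK -polyC1 -polyCN size_exp_XsubC.
rewrite size_polyDl size_pow // size_polyN.
by rewrite (leq_ltn_trans (size_scale_leq _ _)) // size_polyXn ltnS.
Qed.

Lemma trinomial_monic : P \is monic.
Proof.
have size_pow : size (('X + 1) ^+ n : {poly F}) = n.+1.
  by rewrite -[1]opprK -polyC1 -polyCN size_exp_XsubC.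
rewrite monicE lead_coefDl ?size_pow ?size_polyN; last first.
  by rewrite (leq_ltn_trans (size_scale_leq _ _)) // size_polyXn ltnS.
by rewrite -monicE monic_exp // -[1]opprK -polyC1 -polyCN monicXsubC.
Qed.

Lemma root_trinomial x : root P x = ((x + 1) ^+ n == c * x ^+ p).
Proof. by rewrite rootE hornerD hornerN hornerZ hornerXn horner_exp !hornerE subr_eq0. Qed.

(** This combination of P and its derivative eliminates (X + 1)^n and leaves p / (n - p) as the only
    candidate for a nonzero multiple root. *)
Lemma trinomial_deriv :
  'X * ('X + 1) * P^`() =
    n%:R *: ('X * P) + c *: ('X^p * ((n - p)%:R *: 'X - p%:R%:P)).
Proof.
have -> : P^`() = n%:R *: ('X + 1) ^+ n.-1 - (c * p%:R) *: 'X^(p.-1).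
  rewrite derivB derivZ derivXn deriv_exp derivD derivX -polyC1 derivC addr0 mul1r.
  by rewrite -!scaler_nat scalerA.
rewrite /trinomial natrB ?(ltnW hpn) // -!mul_polyC rmorphB /= rmorphM.
have -> : ('X + 1) ^+ n = ('X + 1) * ('X + 1) ^+ n.-1 :> {poly F}.
  by rewrite -exprS prednK // (leq_ltn_trans _ hpn).
have -> : 'X^p = 'X * 'X^(p.-1) :> {poly F} by rewrite -exprS prednK.
ring.
Qed.

Hypothesis char0 : forall k, (0 < k)%N -> k%:R != 0 :> F.
Hypothesis c0 : c != 0.

Let x0 : F := p%:R / (n - p)%:R.

Lemma natr_np_neq0 : (n - p)%:R != 0 :> F.
Proof. by rewrite char0 // subn_gt0. Qed.

(** The k-th power of X - x divides both P and its derivative, hence the remaining term of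
    [trinomial_deriv]; it is coprime to X^p because 0 is not a root of P. *)
Lemma dvdp_trinomial_exp x k : ('X - x%:P) ^+ k.+1 %| P ->
  ('X - x%:P) ^+ k %| 'X - x0%:P.
Proof.
move=> xP.
have x_neq0 : x != 0.
  apply/eqP => xz; have : root P x.
    by rewrite -dvdp_XsubCl; apply: dvdp_trans xP; rewrite exprS dvdp_mulr.
  rewrite root_trinomial xz add0r expr1n expr0n -[p == 0%N]negbK -lt0n hp mulr0.
  by rewrite oner_eq0.
have xP' : ('X - x%:P) ^+ k %| P^`().
  have /dvdpP[q ->] := xP.
  rewrite derivM deriv_exp derivXsubC mul1r /=; apply: dvdp_add.
    by rewrite dvdp_mull // exprS dvdp_mull.
  by rewrite dvdp_mull // -mulr_natl dvdp_mull.
have : ('X - x%:P) ^+ k %| c *: ('X^p * ((n - p)%:R *: 'X - p%:R%:P)).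
  rewrite -(dvdp_addr _ (m := n%:R *: ('X * P))).
    by rewrite -trinomial_deriv dvdp_mull.
  by rewrite -mul_polyC !dvdp_mull // (dvdp_trans _ xP) // exprS dvdp_mull.
rewrite dvdpZr // Gauss_dvdpr; last first.
  rewrite coprimep_expl // coprimep_expr // coprimep_sym coprimep_XsubC.
  by rewrite rootX.
have -> : (n - p)%:R *: 'X - p%:R%:P = (n - p)%:R *: ('X - x0%:P).
  by rewrite scalerBr -!mul_polyC -polyCM [_ * x0]mulrC divfK ?natr_np_neq0.
by rewrite dvdpZr // natr_np_neq0.
Qed.

Lemma trinomial_double_root x : ('X - x%:P) ^+ 2 %| P -> x = x0.
Proof.
by move/dvdp_trinomial_exp; rewrite expr1 dvdp_XsubCl root_XsubC => /eqP.
Qed.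

Lemma trinomial_no_triple_root x : ~~ (('X - x%:P) ^+ 3 %| P).
Proof.
apply/negP => /dvdp_trinomial_exp /dvdp_leq; rewrite polyXsubC_eq0 => /(_ isT).
by rewrite size_exp_XsubC size_XsubC.
Qed.

(** At x0 the identity [trinomial_deriv] reads x0 (x0 + 1) P'(x0) = 0, and x0 and x0 + 1 = n / (n -
    p) are nonzero. *)
Lemma critical_double_root : root P x0 -> ('X - x0%:P) ^+ 2 %| P.
Proof.
move=> Px0; have x0_neq0 : x0 != 0 by rewrite mulf_neq0 ?invr_eq0 ?natr_np_neq0 ?char0.
have x1_neq0 : x0 + 1 != 0.
  have -> : x0 + 1 = n%:R / (n - p)%:R.
    by rewrite -[X in _ + X](divff natr_np_neq0) -mulrDl -natrD (subnKC (ltnW hpn)).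
  by rewrite mulf_neq0 ?invr_eq0 ?natr_np_neq0 ?char0 // (leq_ltn_trans _ hpn).
have P'x0 : P^`().[x0] = 0.
  have x0M : (n - p)%:R * x0 = p%:R by rewrite [LHS]mulrC divfK ?natr_np_neq0.
  clearbody x0; move: (eqP Px0) (congr1 (horner^~ x0) trinomial_deriv); move: (trinomial n p c) => q qx0.
  rewrite !(hornerM, hornerD, hornerN, hornerZ, hornerX, hornerC).
  rewrite qx0 x0M subrr !mulr0 addr0.
  by move/eqP; rewrite !mulf_eq0 (negPf x0_neq0) (negPf x1_neq0) => /eqP.
move: Px0; rewrite -dvdp_XsubCl => /dvdpP[q PE].
move: P'x0; rewrite PE derivM derivXsubC mulr1 hornerD hornerM hornerXsubC subrr mulr0 add0r.
by move=> qx0; rewrite expr2 dvdp_mul // dvdp_XsubCl; apply/rootP.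
Qed.

End Trinomial.

Lemma trinomial_prod (C : closedFieldType) (n p : nat) (c : C) : (p < n)%N ->
  exists rho : 'I_n -> C, trinomial n p c = \prod_i ('X - (rho i)%:P).
Proof.
move=> hpn; have [rs PE] := closed_field_poly_normal (trinomial n p c).
move: PE; rewrite (monicP (trinomial_monic hpn c)) scale1r => PE.
have srs : size rs = n.
  by have := size_trinomial hpn c; rewrite PE size_prod_XsubC => -[].
exists (fun i : 'I_n => rs`_i); by rewrite PE (big_nth 0) srs big_mkord.
Qed.

(** The witness lam0 is the value of (x + 1)^n / x^p at its critical point x0 = p / (n - p). Every
    multiple root equals x0, and x0 is a root of multiplicity exactly two. *)
Lemma specialized_trinomial (C : numClosedFieldType) (n p : nat) :
    (0 < p)%N -> (p < n)%N ->
  exists (lam0 : C) (rho : 'I_n -> C) (i0 j0 : 'I_n),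
    [/\ trinomial n p lam0 = \prod_i ('X - (rho i)%:P), i0 != j0, rho i0 = rho j0,
        rho i0 != 0
      & forall i j, rho i = rho j -> i != j -> i \in [set i0; j0]].
Proof.
move=> hp hpn; have char0 k : (0 < k)%N -> k%:R != 0 :> C by rewrite pnatr_eq0 -lt0n.
pose x0 : C := p%:R / (n - p)%:R.
have np0 : (n - p)%:R != 0 :> C by rewrite char0 // subn_gt0.
have x0_neq0 : x0 != 0 by rewrite mulf_neq0 ?invr_eq0 ?np0 ?char0.
have x1_neq0 : x0 + 1 != 0.
  have -> : x0 + 1 = n%:R / (n - p)%:R.
    by rewrite -[X in _ + X](divff np0) -mulrDl -natrD (subnKC (ltnW hpn)).
  by rewrite mulf_neq0 ?invr_eq0 ?np0 ?char0 // (leq_ltn_trans _ hpn).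
pose lam0 := (x0 + 1) ^+ n / x0 ^+ p.
have lam0_neq0 : lam0 != 0 by rewrite mulf_neq0 ?invr_eq0 ?expf_neq0.
have Px0 : root (trinomial n p lam0) x0.
  by rewrite root_trinomial divfK // expf_neq0.
have [rho PE] := trinomial_prod lam0 hpn.
have dbl := critical_double_root hp hpn char0 Px0.
have [i0 ri0] : exists i0, rho i0 = x0.
  move: Px0; rewrite PE rootE horner_prod => /prodf_eq0[i _].
  by rewrite hornerXsubC subr_eq0 => /eqP xE; exists i.
have [j0 ij0 rj0] : exists2 j0, j0 != i0 & rho j0 = x0.
  move: dbl; rewrite PE (bigD1 i0) //= ri0 expr2 dvdp_mul2l ?polyXsubC_eq0 //.
  rewrite dvdp_XsubCl rootE horner_prod => /prodf_eq0[j ji].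
  by rewrite hornerXsubC subr_eq0 => /eqP xE; exists j.
exists lam0, rho, i0, j0; rewrite ri0 rj0 eq_sym; split=> // i j rij ij.
have ri : rho i = x0.
  apply: (trinomial_double_root hp hpn char0 lam0_neq0).
  by rewrite PE (bigD1 i) //= (bigD1 j) 1?eq_sym //= -rij mulrA -expr2 dvdp_mulr.
rewrite !inE; apply: contraT; rewrite negb_or => /andP[ii0 ijj0].
have := trinomial_no_triple_root hp hpn char0 lam0_neq0 x0.
rewrite PE (bigD1 i0) //= (bigD1 j0) //= (bigD1 i) /=; last by rewrite ii0.
by rewrite ri0 rj0 ri !exprS expr0 mulr1 !mulrA dvdp_mulr.
Qed.

(** * The Galois group *)

(** Enumerating the fibres of c, and then each fibre, gives coordinates on T. They will identify the
    permutations of the roots that preserve the t factors with families of t permutations of m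
    points. *)
Lemma uniform_fibers_coords (T : finType) (S : eqType) (c : T -> S) (t m : nat) :
  #|T| = (t * m)%N -> (0 < m)%N -> (forall x, #|[set y | c y == c x]| = m) ->
  exists e : 'I_t -> 'I_m -> T,
    [/\ forall j k j' k', c (e j k) = c (e j' k') <-> j = j',
        forall j, injective (e j)
      & forall x, exists jk : 'I_t * 'I_m, x = e jk.1 jk.2].
Proof.
move=> cardT m_gt0 cardc; pose P := preim_partition c setT.
have partP : partition P setT := preim_partitionP c setT.
have blockP B : B \in P -> exists x, B = [set y | c y == c x].
  case/imsetP => x _ ->; exists x; apply/setP => y.
  by rewrite !inE eq_sym.
have cardB B : B \in P -> #|B| = m by move=> /blockP[x ->].
have cardP : #|P| = t.
  have := card_uniform_partition cardB partP; rewrite cardsT cardT => /eqP.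
  by rewrite eqn_pmul2r // => /eqP.
pose B (j : 'I_t) := nth set0 (enum P) j.
have BP j : B j \in P by rewrite -mem_enum mem_nth // -cardE cardP.
have B_inj : injective B.
  move=> j j' /eqP; rewrite nth_uniq ?enum_uniq // -?cardE ?cardP // => /eqP.
  exact: val_inj.
have x0 (j : 'I_t) : T.
  have : (0 < #|B j|)%N by rewrite cardB.
  by rewrite card_gt0 => /set0Pn/sigW[].
pose e j (k : 'I_m) := nth (x0 j) (enum (B j)) k.
have eB j k : e j k \in B j by rewrite -mem_enum mem_nth // -cardE cardB.
exists e; split.
- move=> j k j' k'; split=> [cjj'|->].
    apply: B_inj; have [x Bx] := blockP _ (BP j); have [x' Bx'] := blockP _ (BP j').
    have := eB j k; have := eB j' k'; rewrite Bx Bx' !inE cjj' => /eqP -> /eqP <-.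
    by [].
  have [x Bx] := blockP _ (BP j').
  by have := eB j' k; have := eB j' k'; rewrite Bx !inE => /eqP -> /eqP ->.
- move=> j k k' /eqP; rewrite nth_uniq ?enum_uniq // -?cardE ?cardB // => /eqP.
  exact: val_inj.
move=> x; have xP : pblock P x \in P.
  by rewrite pblock_mem // (cover_partition partP).
have xB : x \in pblock P x by rewrite mem_pblock (cover_partition partP).
have jt : (index (pblock P x) (enum P) < t)%N by rewrite -cardP cardE index_mem mem_enum.
have Bj : B (Ordinal jt) = pblock P x by rewrite /B nth_index // mem_enum.
have km : (index x (enum (B (Ordinal jt))) < m)%N.
  by rewrite -(cardB _ (BP (Ordinal jt))) cardE index_mem mem_enum Bj.
by exists (Ordinal jt, Ordinal km); rewrite /e nth_index // mem_enum Bj.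
Qed.

Section Galois.
Variables (C : numClosedFieldType) (K : fieldType) (L : splittingFieldType K).
Variables (iota : {rmorphism C -> L}) (lam : L).
Variables (n p : nat) (hp : (0 < p)%N) (hpn : (p < n)%N).
Hypothesis lam_transc : injective (ev iota lam).
Hypothesis base_ratval : forall z, z \in 1%VS -> ratval (ev iota lam) z.
Hypothesis iota1 : forall c, iota c \in 1%VS.
Hypothesis lam1 : lam \in 1%VS.
Hypothesis hL : splittingFieldFor 1%VS (trinomial n p lam) {:L}%VS.

Local Notation isroot := (isroot n p lam).
Local Notation ev := (ev iota).
Local Notation G := ('Gal({:L} / 1))%g.

(** Since lam = (a + 1)^n / a^p lies in C(a), adjoining a to C(lam) gives C(a). *)
Lemma ratval_adjoin a z : isroot a -> z \in <<1; a>>%VS -> ratval (ev a) z.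
Proof.
move=> ra /Fadjoin_polyP [q /polyOverP q1 ->].
have ea := root_transc hp lam_transc ra.
apply: ratval_horner => //; last by rewrite -[X in ratval _ X](evX iota); apply: ratval_poly.
have evR A : ratval (ev a) (ev lam A).
  rewrite evE; apply: ratval_horner => //; last exact: ratval_lam ra.
  by move=> i; rewrite coef_map -[X in ratval _ X](evC iota a); apply: ratval_poly.
move=> i; have [A [D [_ ->]]] := base_ratval (q1 i).
by apply: ratvalM => //; apply: ratvalV.
Qed.

Lemma isrootP x : reflect (isroot x) (root (trinomial n p lam) x).
Proof. by rewrite root_trinomial; apply: eqP. Qed.

Lemma char0 k : (0 < k)%N -> k%:R != 0 :> L.
Proof. by move=> k0; rewrite -(rmorph_nat iota) fmorph_eq0 pnatr_eq0 -lt0n. Qed.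

(** The roots are distinct because a double root would be the constant p / (n - p), while every root
    is transcendental over C. *)
Lemma roots_exist : exists r : 'I_n -> L,
  [/\ injective r, trinomial n p lam = \prod_i ('X - (r i)%:P)
    & <<1 & codom r>>%VS = {:L}%VS].
Proof.
have [rs Pprod rs_gen] := hL.
have PE : trinomial n p lam = \prod_(z <- rs) ('X - z%:P).
  by apply/eqP; rewrite -eqp_monic // ?trinomial_monic ?monic_prod_XsubC.
have srs : size rs = n.
  by have := size_trinomial hpn lam; rewrite PE size_prod_XsubC => -[].
exists (fun i : 'I_n => rs`_i).
have PEr : trinomial n p lam = \prod_(i < n) ('X - (rs`_i)%:P).
  by rewrite PE (big_nth 0) srs big_mkord.
have -> : codom (fun i : 'I_n => rs`_i) = rs.
  by rewrite codomE -[RHS](mkseq_nth 0) srs /mkseq -val_enum_ord -map_comp.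
split=> // i j rij; apply/eqP; apply: contraT => ij.
pose x := rs`_i.
have dbl : ('X - x%:P) ^+ 2 %| trinomial n p lam.
  by rewrite PEr (bigD1 i) //= (bigD1 j) 1?eq_sym //= -rij mulrA -expr2 dvdp_mulr.
have rx : isroot x.
  by apply/isrootP; rewrite -dvdp_XsubCl (dvdp_trans _ dbl) // expr2 dvdp_mulr.
have lam0 := lam_neq0 lam_transc.
have := trinomial_double_root hp hpn char0 lam0 dbl.
have := not_root_transc (p%:R / (n - p)%:R) (root_transc hp lam_transc rx).
by rewrite fmorph_div !rmorph_nat => /eqP.
Qed.

Variable r : 'I_n -> L.
Hypothesis r_inj : injective r.
Hypothesis r_prod : trinomial n p lam = \prod_i ('X - (r i)%:P).
Hypothesis r_gen : <<1 & codom r>>%VS = {:L}%VS.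

Lemma root_r i : isroot (r i).
Proof.
by apply/isrootP; rewrite r_prod (bigD1 i) //= rootM root_XsubC eqxx.
Qed.

Lemma rootE x : isroot x -> exists i, x = r i.
Proof.
move=> /isrootP; rewrite r_prod rootE horner_prod => /prodf_eq0[i _].
by rewrite hornerXsubC subr_eq0 => /eqP; exists i.
Qed.

Lemma galois_L : galois 1%AS {:L}%AS.
Proof.
apply/splitting_galoisField; exists (trinomial n p lam); split=> //.
  apply: rpredB; last by rewrite polyOverZ // rpredX // polyOverX.
  by rewrite rpredX // rpredD ?polyOverX // rpred1.
have -> : trinomial n p lam = \prod_(z <- codom r) ('X - z%:P).
  by rewrite r_prod big_image.
by rewrite separable_prod_XsubC map_inj_uniq ?enum_uniq.
Qed.

Lemma fixed_adjoin a z :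
  (forall g, g \in G -> g a = a -> g z = z) -> z \in <<1; a>>%VS.
Proof.
move=> fixz; have gala : galois <<1; a>>%AS {:L}%AS.
  by apply: galoisS galois_L; rewrite sub1v subvf.
have /galois_fixedField fixE := gala.
rewrite -[<<1; a>>%VS]fixE; apply/fixedFieldP; first exact: memvf.
move=> g gE; apply: fixz.
  by apply: (subsetP (galS _ _)) gE; apply: sub1v.
by rewrite (fixed_gal _ gE) ?subvf ?memv_adjoin.
Qed.

Lemma fixed_base z : (forall g, g \in G -> g z = z) -> z \in 1%VS.
Proof.
move=> fixz; have /galois_fixedField fixE := galois_L.
by rewrite -[1%VS]fixE; apply/fixedFieldP; first exact: memvf.
Qed.

Lemma gal_iota g c : g \in G -> g (iota c) = iota c.
Proof. by move=> gG; rewrite (fixed_gal _ gG) ?sub1v. Qed.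

Lemma gal_root g x : g \in G -> isroot x -> isroot (g x).
Proof.
move=> gG rx; have := congr1 g (rx : (x + 1) ^+ n = lam * x ^+ p).
by rewrite rmorphM !rmorphXn rmorphD rmorph1 /= [g lam](fixed_gal _ gG) ?sub1v.
Qed.

Lemma gal_eq_roots (g h : gal_of {:L}) : (forall i, g (r i) = h (r i)) -> g = h.
Proof.
pose F := fixedField_aspace [set (g * h^-1)%g].
move=> gh; suff : ({:L}%VS <= F)%VS.
  move=> /subvP fixL; apply/eqP; rewrite eq_mulgV1; apply/gal_eqP => x xL.
  have /mem_fixedFieldP[_ /(_ _ (set11 _)) ->] := fixL x xL.
  by rewrite gal_id.
rewrite -r_gen; apply/Fadjoin_seqP; split; first exact: sub1v.
move=> _ /codomP[i ->]; apply/fixedFieldP; first exact: memvf.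
by move=> _ /set1P->; rewrite galM ?memvf // gh -galM ?memvf // mulgV gal_id.
Qed.

Lemma realize g : g \in G -> exists s : 'S_n, forall i, r (s i) = g (r i).
Proof.
move=> gG; have /fin_all_exists[f fE] : forall i, exists j, r j = g (r i).
  by move=> i; have [j ->] := rootE (gal_root gG (root_r i)); exists j.
have f_inj : injective f.
  by move=> i j fij; have := fE i; rewrite fij fE => /fmorph_inj/r_inj.
by exists (perm f_inj) => i; rewrite permE.
Qed.

Lemma fixed_prod (g : gal_of {:L}) (O : {set 'I_n}) (s : 'S_n) (f : L -> L) :
  (forall i, r (s i) = g (r i)) -> (forall x, g (f x) = f (g x)) ->
  (forall i, (s i \in O) = (i \in O)) ->
  g (\prod_(i in O) f (r i)) = \prod_(i in O) f (r i).
Proof.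
move=> sE gf sO; rewrite rmorph_prod [RHS](reindex_inj (@perm_inj _ s)) /=.
by apply: eq_big => i; rewrite ?sO // gf sE.
Qed.

Lemma big_image_set (O : {set 'I_n}) (f : L -> L) :
  \prod_(x <- [seq r i | i in O]) f x = \prod_(i in O) f (r i).
Proof. by rewrite big_image. Qed.

(** The products over the orbit O of r i are fixed by the group, so they lie in C(lam) and
    [roots_dvd_size] gives n | #|O|, with O nonempty. *)
Lemma gal_transitive i j : exists2 g, g \in G & g (r i) = r j.
Proof.
pose O := [set j | [exists g in G, g (r i) == r j]].
suff /setP/(_ j) : O = setT by rewrite !inE => /exists_inP[g gG /eqP]; exists g.
have iO : i \in O by rewrite inE; apply/exists_inP; exists 1%g; rewrite ?gal_id.
have fixO f z : (forall g x, g \in G -> g (f x) = f (g x)) ->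
    z = \prod_(j in O) f (r j) -> ratval (ev lam) z.
  move=> gf ->; apply: base_ratval; apply: fixed_base => g gG; have [s sE] := realize gG.
  apply: (fixed_prod sE) => [x|k]; first exact: gf.
  rewrite !inE; apply/exists_inP/exists_inP => -[h hG /eqP hE].
    exists (h * g^-1)%g; rewrite ?groupM ?groupV //.
    by rewrite galM ?memvf // hE sE -galM ?memvf // mulgV gal_id.
  by exists (h * g)%g; rewrite ?groupM // galM ?memvf // hE sE.
have : (n %| size [seq r j | j in O])%N.
  apply: (roots_dvd_size hp hpn lam_transc).
  - by move=> x /imageP[k _ ->]; apply: root_r.
  - by apply: (fixO id); rewrite ?big_image_set.
  apply: (fixO (fun x => x + 1)); last by rewrite big_image_set.
  by move=> g x gG; rewrite rmorphD rmorph1.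
rewrite size_image => /dvdn_leq nO; apply/eqP; rewrite eqEcard subsetT cardsT card_ord.
by rewrite nO // card_gt0; apply/set0Pn; exists i.
Qed.

(** * A transposition in the Galois group *)

Lemma gal_ev g a A : g \in G -> g (ev a A) = ev (g a) A.
Proof.
move=> gG; have := @ev_morph _ _ iota (GRing.RMorphism.clone _ _ (g : L -> L) _) a A.
by apply => c; apply: gal_iota.
Qed.

Lemma integral_lincomb a (t : C) (v : 'I_n -> C) (u : 'S_n) : isroot a ->
  integralOver (ev a) (a ^+ p * \sum_(i < n) iota t ^+ i * (r (u i) - iota (v i))).
Proof.
move=> ra; rewrite mulr_sumr; apply: (big_ind (integralOver (ev a))) => [|x y|i _].
- exact: integral0.
- exact: integral_add.
have iotai c : integralOver (ev a) (iota c).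
  by rewrite -(evC iota a); apply: integral_id.
rewrite mulrCA; apply: integral_mul; first by apply: integral_exp.
rewrite mulrBr; apply: integral_sub.
  exact: integral_rootr ra (root_r _).
apply: integral_mul => //; apply: integral_exp.
by rewrite -[X in integralOver _ X](evX iota); apply: integral_id.
Qed.

(** The product over the stabilizer of a is fixed by it, hence lies in C(a). The power of a makes it
    integral over C[a], which is integrally closed. *)
Lemma stabilizer_norm a (H := [set h in G | h a == a]) y :
  isroot a -> (forall h, h \in H -> integralOver (ev a) (a ^+ p * h y)) ->
  exists Q, a ^+ (p * #|H|) * \prod_(h in H) h y = ev a Q.
Proof.
move=> ra yi; have ea := root_transc hp lam_transc ra.
apply: (ratval_integral ea); last first.
  have -> : a ^+ (p * #|H|) * \prod_(h in H) h y = \prod_(h in H) (a ^+ p * h y).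
    by rewrite big_split /= prodr_const exprM.
  apply: (big_ind (integralOver (ev a))) => [|u v|h /yi //]; first exact: integral1.
  exact: integral_mul.
apply: ratval_adjoin => //; apply: fixed_adjoin => g gG ga.
rewrite rmorphM rmorphXn /= ga; congr (_ * _).
have Hg h : ((h * g)%g \in H) = (h \in H).
  rewrite !inE groupMr // galM ?memvf //.
  by apply: andb_id2l => _; rewrite -{2}ga (inj_eq (fmorph_inj g)).
rewrite rmorph_prod [RHS](reindex_inj (mulIg g)) /=.
by apply: eq_big => h; rewrite ?Hg // galM ?memvf.
Qed.

(* Fix g sending r al to r be, where al and be index the double root of the
   specialization rho.  The product of the conjugates of a linear form in the
   roots under the stabilizer of r al is a polynomial in r al, up to a power of
   r al; applying g gives the same polynomial in r be.  Specializing, where r al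
   and r be become equal, and choosing a form that vanishes at rho permuted by g,
   some h fixing r al permutes rho as g does; then h^-1 g swaps r al and r be. *)
Lemma transposition_exists : exists (i j : 'I_n) (g : gal_of {:L}),
  [/\ i != j, g \in G & forall k, r (tperm i j k) = g (r k)].
Proof.
have [lam0 [rho0 [i0 [j0 [rho0_prod ij0 rho_eq rho_neq0 rho0_inj]]]]] :=
  specialized_trinomial C hp hpn.
have [s sP] : exists s : 'S_n, forall q : {mpoly C[n]},
    mmap iota r q = 0 -> q.@[fun i => rho0 (s i)] = 0.
  apply: (@specialization _ _ iota lam lam0 n lam_transc (trinomial n p 'X)).
    by rewrite (map_trinomial (ev lam)) evX.
  by rewrite (map_trinomial (horner_eval lam0)) -rho0_prod; congr trinomial; apply: hornerX.
pose rho i := rho0 (s i); pose al := (s^-1 i0)%g; pose be := (s^-1 j0)%g.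
have rho_al : rho al = rho0 i0 by rewrite /rho permKV.
have rho_be : rho be = rho0 i0 by rewrite /rho permKV rho_eq.
have albe : al != be by rewrite (inj_eq perm_inj).
(* The permutations induced on the indices, with the identity as default outside the group. *)
have [S SP] : exists S : gal_of {:L} -> 'S_n,
    forall g, g \in G -> forall i, r (S g i) = g (r i).
  apply: (@fin_all_exists _ (fun=> 'S_n)
    (fun g w => g \in G -> forall i, r (w i) = g (r i))) => g; have [gG|gG] := boolP (g \in G); last by exists 1%g.
  by have [w wP] := realize gG; exists w.
have [g gG gal_be] := gal_transitive al be.
pose H := [set h in G | h (r al) == r al].
have HG h : h \in H -> h \in G by rewrite inE => /andP[].
have [h hH rho_h] : exists2 h, h \in H & forall i, rho (S h i) = rho (S g i).
  apply: contrapT => /forall2NP noh.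
  pose v i := rho (S g i).
  (* If no h in H permutes rho as g does, each of these polynomials is nonzero. A common non-root t
     then yields one linear form that separates v from every rho permuted by some h in H; the value
     1 is a default outside H. *)
  pose q h : {poly C} :=
    if h \in H then \sum_(i < n) (rho (S h i) - v i) *: 'X^i else 1.
  have q_neq0 h : q h != 0.
    rewrite /q; case: ifP => [hH|_]; last exact: oner_neq0.
    apply/eqP => q0; have [//|[]] := noh h => i; apply/eqP; rewrite -subr_eq0 -/(v i).
    have /eqP := congr1 (fun w : {poly C} => w`_i) q0; rewrite coef0 coef_sum.
    rewrite (bigD1 i) //= coefZ coefXn eqxx mulr1 big1 ?addr0 // => k ki.
    by rewrite coefZ coefXn (inj_eq val_inj) eq_sym (negPf ki) mulr0.
  have [t tP] := common_nonroot q_neq0.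
  pose Fm (u : 'S_n) : {mpoly C[n]} := \sum_(i < n) t ^+ i *: ('X_(u i) - (v i)%:MP).
  have Fm_rho (u : 'S_n) : (Fm u).@[rho] = \sum_(i < n) t ^+ i * (rho (u i) - v i).
    rewrite rmorph_sum; apply: eq_bigr => i _ /=.
    by rewrite mevalZ mevalB mevalXU mevalC.
  pose y := \sum_(i < n) iota t ^+ i * (r i - iota (v i)).
  have gal_y (h : gal_of {:L}) (u : 'S_n) : h \in G -> (forall i, r (u i) = h (r i)) ->
      h y = \sum_(i < n) iota t ^+ i * (r (u i) - iota (v i)).
    move=> hG uE; rewrite rmorph_sum; apply: eq_bigr => i _.
    by rewrite rmorphM rmorphXn rmorphB /= !gal_iota // uE.
  have Fm_r h (u : 'S_n) : h \in G -> (forall i, r (u i) = h (r i)) ->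
      mmap iota r (Fm u) = h y.
    move=> hG uE; rewrite (gal_y h u) // rmorph_sum; apply: eq_bigr => i _ /=.
    by rewrite mmapZ mmapB mmapXU mmapC rmorphXn.
  have [Q QE] : exists Q, r al ^+ (p * #|H|) * \prod_(h in H) h y = ev (r al) Q.
    apply: stabilizer_norm; first exact: root_r.
    move=> h /HG hG; rewrite (gal_y h (S h)) ?SP //; last by move=> i; rewrite SP.
    exact/integral_lincomb/root_r.
  set N := (p * #|H|)%N in QE.
  (* The relation between the norm of y and Q, written in the variables so that it can be
     specialized. *)
  pose rel i (T : gal_of {:L} -> 'S_n) : {mpoly C[n]} :=
    'X_i ^+ N * \prod_(h in H) Fm (T h) - (map_poly (@mpolyC n C) Q).['X_i].
  have rel_rho i T : (rel i T).@[rho] =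
      rho i ^+ N * \prod_(h in H) (Fm (T h)).@[rho] - Q.[rho i].
    rewrite /rel mevalB mevalM rmorphXn /= mevalXU rmorph_prod /=.
    by rewrite /meval mmap_horner map_poly_id.
  have rel_r i T : mmap iota r (rel i T) =
      r i ^+ N * \prod_(h in H) mmap iota r (Fm (T h)) - ev (r i) Q.
    by rewrite /rel mmapB rmorphM rmorphXn /= mmapXU rmorph_prod mmap_horner.
  have relS : (rel al S).@[rho] = 0.
    apply: sP; rewrite rel_r (eq_bigr (fun h : gal_of {:L} => h y)) ?QE ?subrr //.
    by move=> h /HG hG; apply: Fm_r => // i; rewrite SP.
  (* Applying g to the relation replaces r al by r be and each conjugate by h by the conjugate by
     [h * g]. *)
  have relSg : (rel be (fun h => S h * S g)%g).@[rho] = 0.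
    apply: sP; rewrite rel_r (eq_bigr (fun h : gal_of {:L} => g (h y))).
      by rewrite -gal_be -gal_ev // -QE rmorphM rmorphXn rmorph_prod subrr.
    move=> h /HG hG; rewrite (Fm_r (h * g)%g) ?groupM ?galM ?memvf // => i.
    by rewrite permM !SP // galM ?memvf.
  (* The factor h = 1 vanishes, since v is rho permuted by g. *)
  have prod0 : \prod_(h in H) (Fm (S h * S g)%g).@[rho] = 0.
    rewrite (bigD1 1%g) /=; last by rewrite inE group1 gal_id eqxx.
    rewrite Fm_rho big1 ?mul0r // => i _.
    have -> : S 1%g = 1%g by apply/permP => k; apply: r_inj; rewrite SP // gal_id perm1.
    by rewrite mul1g /v subrr mulr0.
  (* At the common value of rho at al and be, the second relation gives Q = 0. The first then makes
     some factor vanish, against the choice of t. *)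
  move: relS relSg; rewrite !rel_rho rho_al rho_be prod0 mulr0 => relS relSg.
  move/eqP: relS; rewrite -(subr0_eq relSg) subr0 mulf_eq0 expf_eq0 (negPf rho_neq0) andbF.
  move=> /prodf_eq0[h hH]; rewrite Fm_rho => /eqP F0.
  move/eqP: (tP h); apply; rewrite /q hH horner_sum -[RHS]F0; apply: eq_bigr => i _.
  by rewrite hornerZ hornerXn mulrC.
have w_eq i : rho (((S h)^-1 * S g)%g i) = rho i.
  by rewrite permM -rho_h permKV.
have hal : h (r al) = r al by move: hH; rewrite inE => /andP[_ /eqP].
have Shal : S h al = al by apply: r_inj; rewrite SP ?HG.
have wal : ((S h)^-1 * S g)%g al = be.
  by rewrite permM -{1}Shal permK; apply: r_inj; rewrite SP.
exists al, be, (h^-1 * g)%g; split=> // [|k].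
  by apply: groupM => //; rewrite groupV HG.
(* The permutation w preserves rho, whose only coincidence is between al and be, so w moves no other
   index; and it sends al to be. *)
have -> : tperm al be = ((S h)^-1 * S g)%g.
  apply/permP => i; set w := ((S h)^-1 * S g)%g in w_eq wal *.
  have w_set j : w j != j -> j \in [set al; be].
    move=> wj; have := rho0_inj (s j) (s (w j)) (esym (w_eq j)).
    rewrite (inj_eq perm_inj) eq_sym => /(_ wj).
    by rewrite !inE /al /be -!(can2_eq (permK s) (permKV s)).
  case: tpermP => [->|->|/eqP nal /eqP nbe]; first by rewrite wal.
    apply/eqP; rewrite eq_sym; apply: contraT => wbe.
    have wbe_neq : w be != be by rewrite -{2}wal (inj_eq perm_inj) eq_sym.
    have : w (w be) != w be by rewrite (inj_eq perm_inj).
    by move=> /w_set; rewrite !inE (negPf wbe) (negPf wbe_neq).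
  apply/eqP; rewrite eq_sym; apply: contraT => /w_set.
  by rewrite !inE (negPf nal) (negPf nbe).
rewrite permM SP // galM ?memvf //; congr (g _).
by rewrite -[in RHS](permKV (S h) k) (SP h) ?HG // -galM ?memvf // mulgV gal_id.
Qed.

(** * The t factors of the trinomial *)

Variables (t m q : nat).
Hypotheses (tm : n = (t * m)%N) (tq : p = (t * q)%N) (mq : coprime m q).

Lemma t_gt0 : (0 < t)%N.
Proof. by move: hp; rewrite tq muln_gt0 => /andP[]. Qed.

Lemma q_lt_m : (q < m)%N.
Proof. by move: hpn; rewrite tm tq ltn_pmul2l ?t_gt0. Qed.

Lemma q_gt0 : (0 < q)%N.
Proof. by move: hp; rewrite tq muln_gt0 => /andP[]. Qed.

(** The t-th root of [lam] attached to the root x; it tells to which of the t factors x belongs. *)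
Definition mu (x : L) := (x + 1) ^+ m / x ^+ q.

Lemma mu_exp x : isroot x -> mu x ^+ t = lam.
Proof.
move=> rx; rewrite (lam_root hp rx) /mu expr_div_n -!exprM.
by rewrite mulnC -tm [(q * t)%N]mulnC -tq.
Qed.

Lemma mu_neq0 x : isroot x -> mu x != 0.
Proof.
move=> rx; apply/eqP => mu0; have := lam_neq0 lam_transc.
by rewrite -(mu_exp rx) mu0 expr0n -[t == 0%N]negbK -lt0n t_gt0 eqxx.
Qed.

Lemma gal_mu g x : g \in G -> g (mu x) = mu (g x).
Proof. by move=> gG; rewrite /mu fmorph_div !rmorphXn rmorphD rmorph1. Qed.

Lemma mu_ratio x y : isroot x -> isroot y -> exists c, mu x = iota c * mu y.
Proof.
move=> rx ry; have [||c cE] := @unity_root_const _ _ iota (mu x / mu y) t.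
- exact: t_gt0.
- by rewrite expr_div_n !mu_exp // divff // (lam_neq0 lam_transc).
by exists c; rewrite -cE divfK // mu_neq0.
Qed.

(** The values of [mu] at the roots differ by constants, which g fixes. *)
Lemma gal_mu_fix g x y : g \in G -> isroot x -> isroot y ->
  g (mu x) = mu x -> g (mu y) = mu y.
Proof.
move=> gG rx ry gx; have [c ->] := mu_ratio ry rx.
by rewrite rmorphM /= gx gal_iota.
Qed.

(* The roots of the factor (x + 1)^m - mu (r i) * x^q of the trinomial. *)
Definition colour i : {set 'I_n} := [set j | mu (r j) == mu (r i)].

(** As a difference of t-th powers, the trinomial is divisible by (x + 1)^m - mu (r i) x^q. This
    factor of degree m is a product over some of the distinct roots, namely those of the colour of
    i. *)
Lemma card_colour i : #|colour i| = m.
Proof.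
have dvdP : trinomial m q (mu (r i)) %| \prod_(z <- codom r) ('X - z%:P).
  rewrite big_image -r_prod /trinomial tm tq mulnC exprM mulnC exprM.
  have -> : lam *: ('X^q ^+ t) = (mu (r i) *: 'X^q) ^+ t.
    by rewrite exprZn mu_exp //; apply: root_r.
  by rewrite subrXX dvdp_mulr.
have [b bE] := dvdp_prod_XsubC dvdP.
have {}bE : trinomial m q (mu (r i)) = \prod_(z <- mask b (codom r)) ('X - z%:P).
  by apply/eqP; rewrite -eqp_monic // ?trinomial_monic ?monic_prod_XsubC ?q_lt_m.
have := size_trinomial q_lt_m (mu (r i)); rewrite bE size_prod_XsubC => -[<-].
have codom_uniq : uniq (codom r) by rewrite map_inj_uniq ?enum_uniq.
rewrite -(size_image r); apply/perm_size/uniq_perm.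
- by rewrite map_inj_uniq ?enum_uniq.
- exact: mask_uniq.
have colE j : (j \in colour i) = (r j \in mask b (codom r)).
  have rq0 : r j ^+ q != 0 by rewrite expf_neq0 // (root_neq0 hp (root_r j)).
  by rewrite inE -root_prod_XsubC -bE root_trinomial -(inj_eq (mulIf rq0)) divfK.
move=> x; apply/imageP/idP => [[j jc ->]|xb]; first by rewrite -colE.
have /codomP[j xE] := mem_mask xb.
by exists j; rewrite // colE -xE.
Qed.

(** * Transpositions and permutations preserving the factors *)

Definition swappable i j :=
  [exists g in G, [forall k, r (tperm i j k) == g (r k)]].

Lemma swappableP i j :
  reflect (exists2 g, g \in G & forall k, r (tperm i j k) = g (r k)) (swappable i j).
Proof.
apply: (iffP exists_inP) => -[g gG gP]; exists g => //.
  by move=> k; apply/eqP; apply: (forallP gP).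
by apply/forallP => k; apply/eqP.
Qed.

Lemma swappable_refl i : swappable i i.
Proof.
apply/swappableP; exists 1%g => // k.
by rewrite tperm1 perm1 gal_id.
Qed.

Lemma swappable_conj g (s : 'S_n) i j : g \in G -> (forall k, r (s k) = g (r k)) ->
  swappable i j -> swappable (s i) (s j).
Proof.
move=> gG sE /swappableP[h hG hE]; apply/swappableP.
exists (g^-1 * h * g)%g; first by rewrite !groupM ?groupV.
move=> k; rewrite -tpermJ conjgE !permM sE hE !galM ?memvf //; congr (g (h _)).
by rewrite -[in RHS](permKV s k) sE -galM ?memvf // mulgV gal_id.
Qed.

(** As m > q > 0, the colour of i has another element k. If j had another colour, the swap would fix
    r k, hence mu (r k) = mu (r i), but would send mu (r i) to mu (r j). *)
Lemma swappable_colour i j : swappable i j -> j \in colour i.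
Proof.
move=> /swappableP[g gG gP]; rewrite inE; apply: contraT => mu_neq.
have [k kc ki] : exists2 k, k \in colour i & k != i.
  have : (0 < #|colour i :\ i|)%N.
    rewrite -(ltn_add2l (i \in colour i)) -cardsD1 card_colour addn0 inE eqxx.
    exact: leq_ltn_trans q_gt0 q_lt_m.
  by rewrite card_gt0 => /set0Pn[k]; rewrite !inE => /andP[ki kc]; exists k; rewrite ?inE.
have kj : k != j by apply: contraNneq mu_neq => <-; move: kc; rewrite inE.
have gi : g (r i) = r j by rewrite -gP tpermL.
have gk : g (r k) = r k by rewrite -gP tpermD // eq_sym.
by move: kc mu_neq; rewrite inE => /eqP muk; rewrite -gi -gal_mu // -muk gal_mu // gk eqxx.
Qed.

(** One transposition exists; conjugate it by an automorphism that brings it to i. *)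
Lemma swappable_exists i : exists2 j, j != i & swappable i j.
Proof.
have [i0 [j0 [h [ij hG hP]]]] := transposition_exists.
have [g gG gi] := gal_transitive i0 i; have [s sE] := realize gG.
have si : s i0 = i by apply: r_inj; rewrite sE.
exists (s j0); first by rewrite -si (inj_eq perm_inj) eq_sym.
by rewrite -{1}si; apply: swappable_conj sE _ => //; apply/swappableP; exists h.
Qed.

Lemma colour_swappable i j : j \in colour i -> swappable i j.
Proof.
pose B := [set k | swappable i k].
suff -> : colour i = B by rewrite inE.
have sBc : B \subset colour i.
  by apply/subsetP=> k; rewrite inE; apply: swappable_colour.
apply/esym/eqP; rewrite eqEcard sBc card_colour.
have iB : i \in B by rewrite inE swappable_refl.
have [k ki sik] := swappable_exists i; have /swappableP[g gG gP] := sik.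
have ra := root_r i.
have rat f z : (forall g x, g \in G -> g (f x) = f (g x)) ->
    z = \prod_(j in B) f (r j) -> ratval (ev (r i)) z.
  move=> gf ->; apply: ratval_adjoin => //; apply: fixed_adjoin => h hG hi.
  have [s sE] := realize hG; have si : s i = i by apply: r_inj; rewrite sE.
  apply: (fixed_prod sE) => [x|l]; first exact: gf.
  rewrite !inE; apply/idP/idP => [|sl]; last first.
    by rewrite -{1}si; apply: swappable_conj sE _.
  have sVE l' : r ((s^-1)%g l') = (h^-1)%g (r l').
    by rewrite -[in RHS](permKV s l') sE -galM ?memvf // mulgV gal_id.
  by move/(swappable_conj (groupVr hG) sVE); rewrite permK -{1}si permK.
(* The swap of i and k permutes B, which contains both, so it fixes the product over B while it
   moves r i. *)
have gB : g (\prod_(j in B) r j) = \prod_(j in B) r j.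
  apply: (@fixed_prod g B (tperm i k) id) => // l; rewrite !inE.
  by case: tpermP => [->|->|//]; rewrite ?sik ?swappable_refl.
have : (n %| p * size [seq r j | j in B])%N.
  have := @conj_roots_dvd_size _ _ iota n p hp hpn lam lam_transc
            (GRing.RMorphism.clone _ _ (g : L -> L) _) (r i).
  apply => //.
  - by move=> c; apply: gal_iota.
  - by rewrite /= -gP tpermL (inj_eq r_inj).
  - by apply: gal_root.
  - by move=> x /imageP[l _ ->]; apply: root_r.
  - by rewrite big_image.
  - by apply: (rat id); rewrite ?big_image_set.
  apply: (rat (fun x => x + 1)); last by rewrite big_image_set.
  by move=> g' x g'G; rewrite rmorphD rmorph1.
have B_gt0 : (0 < #|B|)%N by apply/card_gt0P; exists i.
(* Cancelling t in n | p #|B| leaves m | q #|B|, and m is coprime to q. *)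
rewrite size_image; move: #|B| B_gt0 => b b_gt0.
by rewrite tm tq -mulnA dvdn_pmul2l ?t_gt0 // Gauss_dvdr // => /dvdn_leq; apply.
Qed.

(** Induction on the number of moved indices: composing s with the swap of i and s i, realized
    because they share a colour, fixes i and moves no new index. *)
Lemma colour_perm_realized (s : 'S_n) : (forall i, mu (r (s i)) = mu (r i)) ->
  exists2 g, g \in G & forall k, r (s k) = g (r k).
Proof.
have [N] := ubnP #|[set k | s k != k]|; elim: N s => // N IH s sN sc.
have [/existsP[i si]|] := boolP [exists i, s i != i]; last first.
  rewrite negb_exists => /forallP s1; exists 1%g => // k.
  by rewrite gal_id; have := s1 k; rewrite negbK => /eqP ->.
have /swappableP[h hG hP] : swappable i (s i).
  by apply: colour_swappable; rewrite inE sc.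
pose s' := (s * tperm i (s i))%g.
have s'i : s' i = i by rewrite permM tpermR.
have s'_fix k : s k = k -> s' k = k.
  move=> sk; rewrite permM sk tpermD //; apply: contraNneq si.
    by move=> ->; rewrite sk.
  move=> sik; have ik : i = k by apply: (@perm_inj _ s); rewrite sik sk.
  by rewrite ik sk.
have [||g gG gP] := IH s'.
- rewrite -ltnS (leq_trans _ sN) // ltnS; apply: proper_card; apply/properP; split.
    by apply/subsetP => k; rewrite !inE; apply: contraNneq => /s'_fix ->.
  by exists i; rewrite inE ?s'i ?eqxx.
- move=> k; rewrite permM; case: tpermP => [ski|/perm_inj ->|_ _]; rewrite ?sc //.
  by rewrite -ski sc.
exists (g * h)%g; first exact: groupM.
move=> k; rewrite galM ?memvf // -gP -hP /s' !permM.
by rewrite tpermK.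
Qed.

(** * The stabilizer of mu and the cyclic quotient *)

Variable i0 : 'I_n.
Let mu0 := mu (r i0).
Local Notation N := ('Gal({:L} / <<1; mu0>>))%g.

Lemma mem_colour_stabilizer g : (g \in N) = (g \in G) && (g mu0 == mu0).
Proof.
apply/idP/andP => [gN|[gG /eqP gmu]].
  split; first by apply: (subsetP (galS _ _)) gN; apply: sub1v.
  by rewrite (fixed_gal _ gN) ?subvf ?memv_adjoin.
rewrite gal_kHom ?subvf //; apply/kAHomP => a aE.
have : (<<1; mu0>> <= fixedField [set g])%VS.
  apply/FadjoinP; rewrite sub1v; split=> //.
  by apply/fixedFieldP; rewrite ?memvf // => _ /set1P ->.
by move=> /subvP/(_ a aE)/mem_fixedFieldP[_ ->]; rewrite ?set11.
Qed.

Lemma colour_stabilizer_fix g i : g \in N -> g (mu (r i)) = mu (r i).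
Proof.
rewrite mem_colour_stabilizer => /andP[gG /eqP g0].
exact: gal_mu_fix gG (root_r i0) (root_r i) g0.
Qed.

(** The conjugates of mu0 are again values of [mu] at roots, and an element of N fixes all of
    these. *)
Lemma colour_stabilizer_normal : (N <| G)%g.
Proof.
apply/andP; split; first by apply: galS; apply: sub1v.
apply/subsetP => g gG; rewrite inE; apply/subsetP => _ /imsetP[h hN ->].
have hG : h \in G by move: hN; rewrite mem_colour_stabilizer => /andP[].
rewrite mem_colour_stabilizer groupJ //= conjgE !galM ?memvf //.
have gVG : (g^-1)%g \in G by rewrite groupV.
have [i iE] := rootE (gal_root gVG (root_r i0)).
rewrite [(g^-1)%g mu0]gal_mu // iE (colour_stabilizer_fix _ hN) -iE -gal_mu //.
by rewrite -galM ?memvf // mulVg gal_id.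
Qed.

(** The Kummer character sending g to g mu0 / mu0, read off on a representative of the coset;
    [chi_coset] shows that the choice does not matter. *)
Let chi (x : coset_of N) : L := (repr x : gal_of {:L}) mu0 / mu0.

Lemma chi_coset g : g \in G -> chi (coset N g) = g mu0 / mu0.
Proof.
move=> gG; rewrite /chi val_coset ?(subsetP (normal_norm colour_stabilizer_normal)) //.
case: repr_rcosetP => h hN; rewrite galM ?memvf //.
by rewrite (colour_stabilizer_fix i0 hN).
Qed.

Lemma mu0_neq0 : mu0 != 0. Proof. exact: mu_neq0 (root_r i0). Qed.

(** The quotient g mu0 / mu0 is a constant, so the second automorphism fixes it. *)
Lemma chiM : {in (G / N)%g &, {morph chi : u v / (u * v)%g >-> u * v}}.
Proof.
move=> _ _ /morphimP[g gN gG ->] /morphimP[h hN hG ->].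
rewrite -morphM // !chi_coset ?groupM // galM ?memvf //.
have [c cE] := mu_ratio (gal_root gG (root_r i0)) (root_r i0).
have {}cE : g mu0 = iota c * mu0 by rewrite gal_mu.
rewrite cE rmorphM /= gal_iota // -/mu0 mulfK ?mu0_neq0 // mulrA.
by [].
Qed.

Lemma chi1 : {in (G / N)%g, forall u, chi u = 1 <-> u = 1%g}.
Proof.
move=> _ /morphimP[g gN gG ->]; rewrite chi_coset //; split=> [g1|].
  apply: coset_id; rewrite mem_colour_stabilizer gG /=.
  by rewrite -[g mu0](divfK mu0_neq0) g1 mul1r.
by move=> /(coset_idr gN) /(colour_stabilizer_fix i0) ->; rewrite divff ?mu0_neq0.
Qed.

(** Through [chi] the quotient embeds into the multiplicative group of a field. *)
Lemma quotient_cyclic : cyclic (G / N)%g.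
Proof. exact: field_mul_group_cyclic chiM chi1. Qed.

Lemma chiX u k : u \in (G / N)%g -> chi (u ^+ k)%g = chi u ^+ k.
Proof.
move=> uQ; elim: k => [|k IH]; first by rewrite expr0; apply/chi1; rewrite ?group1.
by rewrite expgS exprS chiM ?groupX // IH.
Qed.

(** The order d divides t because the values of [chi] are t-th roots of unity. Conversely mu0^d is
    fixed by the group, so it lies in C(lam); its t-th power is lam^d, whence t | d. *)
Lemma card_quotient_colour : #|(G / N)%g| = t.
Proof.
apply/eqP; rewrite eqn_dvd; apply/andP; split.
  have /cyclicP[x xE] := quotient_cyclic.
  have xQ : x \in (G / N)%g by rewrite xE cycle_id.
  rewrite xE -/(#[x]%g) order_dvdn; apply/eqP/(chi1 (groupX _ xQ)); rewrite chiX //.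
  have /morphimP[g gN gG ->] := xQ.
  have ri := root_r i0; have gri := gal_root gG ri.
  by rewrite chi_coset // expr_div_n gal_mu // !mu_exp // divff // (lam_neq0 lam_transc).
set d := #|_|; have : ratval (ev lam) (mu0 ^+ d).
  apply/base_ratval/fixed_base => g gG; rewrite rmorphXn /=.
  have gQ : coset N g \in (G / N)%g.
    by apply: mem_quotient.
  have : chi (coset N g) ^+ d = 1.
    by rewrite -chiX // expg_cardG //; apply/chi1; rewrite ?group1.
  rewrite chi_coset // expr_div_n => /(canRL (divfK _)) ->; rewrite ?mul1r //.
  by rewrite expf_neq0 // mu0_neq0.
move=> muR; apply: (@ratval_pow_monomial _ _ _ lam_transc t 1 d _ t_gt0 muR).
  exact: oner_neq0.
by rewrite scale1r evXn -exprM mulnC exprM mu_exp //; apply: root_r.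
Qed.

Lemma colour_stabilizer_isog : N \isog [set: {dffun forall _ : 'I_t, 'S_m}].
Proof.
have cardT : #|'I_n| = (t * m)%N by rewrite card_ord.
have m_gt0 : (0 < m)%N := leq_ltn_trans (leq0n q) q_lt_m.
have [e [e_col e_inj e_surj]] := uniform_fibers_coords cardT m_gt0 card_colour.
have [co coE] : exists co : 'I_n -> 'I_t * 'I_m, forall i, i = e (co i).1 (co i).2.
  exact: (@fin_all_exists _ (fun=> ('I_t * 'I_m)%type) _ e_surj).
have co_e j k : co (e j k) = (j, k).
  have eE := coE (e j k); case: (co _) eE => j' k' /= eE.
  have jj : j = j' by apply/(e_col j k j' k'); rewrite -eE.
  by move: eE; rewrite -jj => /e_inj ->.
(* A family x acts on the coordinates by (j, k) -> (j, x j k); this preserves colours, so it is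
   realized in the group. *)
have [psi psiP] : exists psi : {dffun forall _ : 'I_t, 'S_m} -> gal_of {:L},
    forall x, psi x \in G /\ forall j k, psi x (r (e j k)) = r (e j (x j k)).
  apply: (@fin_all_exists _ (fun=> gal_of {:L}) (fun (x : {dffun forall _ : 'I_t, 'S_m}) g =>
    g \in G /\ forall j k, g (r (e j k)) = r (e j (x j k)))) => x.
  pose f i := e (co i).1 (x (co i).1 (co i).2).
  have f_inj : injective f.
    move=> i i' /(congr1 co); rewrite !co_e => -[co1 co2].
    rewrite (coE i) (coE i') -co1; congr (e _ _).
    by move: co2; rewrite -co1 => /perm_inj.
  have [i|g gG gE] := colour_perm_realized (s := perm f_inj).
    by rewrite permE [in RHS](coE i); apply/e_col.
  by exists g; split=> // j k; rewrite -gE permE /f co_e.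
have psiM : {in setT &, {morph psi : x y / (x * y)%g}}.
  move=> x y _ _; apply: gal_eq_roots => i; rewrite (coE i).
  by rewrite galM ?memvf // !(psiP _).2 dffunM permM.
have psi_inj : ('injm (Morphism psiM))%g.
  apply/injmP => x y _ _ /= xy; apply/ffunP => j; apply/permP => k.
  apply/(e_inj j)/r_inj; rewrite -!(psiP _).2 xy //.
have psi_im : (Morphism psiM @* setT)%g = N.
  apply/setP => g; apply/morphimP/idP => [[x _ _ ->]|gN] /=.
    rewrite mem_colour_stabilizer (psiP x).1 gal_mu ?(psiP x).1 // /mu0 (coE i0).
    by rewrite (psiP x).2; apply/eqP/e_col.
  have gG : g \in G by move: gN; rewrite mem_colour_stabilizer => /andP[].
  have [s sE] := realize gG.
  (* An element of N fixes the values of [mu], so it preserves the first coordinate. *)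
  have sco j k : s (e j k) = e j (co (s (e j k))).2.
    rewrite {1}(coE (s (e j k))); congr (e _ _); apply/(e_col _ (co (s (e j k))).2 _ k).
    by rewrite -coE sE -gal_mu // (colour_stabilizer_fix _ gN).
  have [x xE] : exists x : 'I_t -> 'S_m, forall j k, s (e j k) = e j (x j k).
    apply: (@fin_all_exists _ (fun=> 'S_m) (fun j w => forall k, s (e j k) = e j (w k))) => j.
    have h_inj : injective (fun k => (co (s (e j k))).2).
      by move=> k k' kk; apply/(e_inj j)/(@perm_inj _ s); rewrite sco [RHS]sco kk.
    by exists (perm h_inj) => k; rewrite permE.
  exists [ffun j => x j]; rewrite ?inE //; apply: gal_eq_roots => i.
  by rewrite (coE i) (psiP _).2 ffunE -xE sE.
by have := sub_isog (subxx [set: _]%G) psi_inj; rewrite psi_im isog_sym.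
Qed.

Lemma galois_structure : exists H : {group gal_of {:L}},
  [/\ (H <| G)%g, H \isog [set: {dffun forall _ : 'I_t, 'S_m}],
      cyclic (G / H)%g & #|(G / H)%g| = t].
Proof.
exists 'Gal({:L}%VS / <<1; mu0>>)%G; split => /=.
- exact: colour_stabilizer_normal.
- exact: colour_stabilizer_isog.
- exact: quotient_cyclic.
- exact: card_quotient_colour.
Qed.

End Galois.

(** * Transfer to the field of rational functions *)

Lemma fraction_split (R : idomainType) (x : {fraction R}) :
  exists a b : R, b != 0 /\ x = tofrac a / tofrac b.
Proof.
elim/quotW: x => y; have d0 := denom_ratioP y.
exists (\n_y), (\d_y); split=> //; apply: (mulIf (x := tofrac \d_y)).
  by rewrite tofrac_eq0.
rewrite divfK ?tofrac_eq0 //; unlock tofrac.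
rewrite -[LHS]FracField.pi_mul; apply/eqmodP; rewrite /= FracField.equivfE /FracField.mulf.
by rewrite !numden_Ratio ?mulr1 ?mul1r ?oner_eq0 // mulrC.
Qed.

Lemma ev_poly_gen (C : numClosedFieldType) (L : fieldType)
    (phi : {rmorphism {poly C} -> L}) (iota : {rmorphism C -> L}) (A : {poly C}) :
  (forall c, iota c = phi c%:P) -> ev iota (phi 'X) A = phi A.
Proof.
move=> iotaE; have mE : map_poly iota A = map_poly phi (map_poly polyC A).
  by rewrite -map_poly_comp; apply: eq_map_poly => c; apply: iotaE.
by rewrite evE mE horner_map; congr (phi _); apply: comp_polyXr.
Qed.

Lemma galois_trinomial (C : numClosedFieldType) (K : fieldType)
    (iota : {rmorphism C -> K}) (lam : K) (n p t : nat)
    (L : splittingFieldType K) :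
  (forall k, ratval (ev iota lam) k) -> injective (ev iota lam) ->
  (0 < p)%N -> (p < n)%N -> gcdn n p = t ->
  splittingFieldFor 1%VS (map_poly (in_alg L) (trinomial n p lam)) {:L}%VS ->
  exists N : {group gal_of {:L}},
    [/\ (N <| 'Gal({:L} / 1))%g,
        N \isog [set: {dffun forall _ : 'I_t, 'S_(n %/ t)}],
        cyclic ('Gal({:L} / 1) / N)%g
      & #|('Gal({:L} / 1) / N)%g| = t].
Proof.
move=> fracK lam_transc hp hpn ht.
pose iotaL : {rmorphism C -> L} := [the {rmorphism C -> L} of in_alg L \o iota].
have evL A : ev iotaL (in_alg L lam) A = in_alg L (ev iota lam A).
  by rewrite !evE -horner_map -map_poly_comp.
have lamL_transc : injective (ev iotaL (in_alg L lam)).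
  by move=> A B; rewrite !evL => /fmorph_inj /lam_transc.
have base_ratval z : z \in 1%VS -> ratval (ev iotaL (in_alg L lam)) z.
  case/vlineP => k ->; have [A [D [D0 ->]]] := fracK k.
  by exists A, D; split; rewrite // !evL -[LHS]/(in_alg L _) fmorph_div.
have in1 k : k%:A \in (1%VS : {vspace L}) by rewrite rpredZ // rpred1.
have iota1 c : iotaL c \in 1%VS by apply: in1.
rewrite map_trinomial => hL.
have [r [r_inj r_prod r_gen]] := roots_exist hp hpn lamL_transc hL.
have t_gt0 : (0 < t)%N by rewrite -ht gcdn_gt0 hp orbT.
have tm : n = (t * (n %/ t))%N by rewrite mulnC divnK // -ht dvdn_gcdl.
have tq : p = (t * (p %/ t))%N by rewrite mulnC divnK // -ht dvdn_gcdr.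
have mq : coprime (n %/ t) (p %/ t).
  by rewrite /coprime -(eqn_pmul2l t_gt0) muln_gcdr -tm -tq ht muln1.
(* Any root may select the t-th root of lam; index 0 exists because n > p. *)
pose i0 : 'I_n := Ordinal (leq_ltn_trans (leq0n p) hpn).
exact: (galois_structure hp hpn lamL_transc base_ratval iota1 (in1 lam) hL
  r_inj r_prod r_gen tm tq mq i0).
Qed.

Theorem mainTheorem4 (R : realType) (n p t : nat)
    (hp : (0 < p)%N) (hpn : (p < n)%N) (ht : gcdn n p = t)
    (L : splittingFieldType (ratfun R))
    (hL : is_splitting_field L (lambda_poly R n p)) :
  exists N : {group gal_of {:L}%AS},
    [/\ (N <| 'Gal({:L} / 1))%g,
        N \isog [set: {dffun forall _ : 'I_t, 'S_(n %/ t)}],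
        cyclic ('Gal({:L} / 1) / N)%g
      & #|('Gal({:L} / 1) / N)%g| = t].
Proof.
pose C : numClosedFieldType := R[i].
pose phi : {rmorphism {poly C} -> ratfun R} := @tofrac {poly C}.
pose iota : {rmorphism C -> ratfun R} := [the {rmorphism C -> ratfun R} of phi \o polyC].
(* Substituting lambda for X is the canonical embedding of C[X] into its fraction field, hence
   injective. *)
have evphi A : ev iota (lambda R) A = phi A by apply: ev_poly_gen.
have lam_transc : injective (ev iota (lambda R)).
  by move=> A B; rewrite !evphi => /eqP; rewrite tofrac_eq => /eqP.
have fracK k : ratval (ev iota (lambda R)) k.
  have [A [D [D0 kE]]] := fraction_split k.
  by exists A, D; rewrite !evphi.
have X := galois_trinomial fracK lam_transc hp hpn ht hL.
exact: X.
Qed.
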